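(* Let $\hat a_n,\hat b_n,\hat c_n,\hat d_n,\hat e_n,\hat f_n,\hat g_n,\hat h_n,\hat k_n,\hat v_n$ denote the sums of the values of the vertices of type $A,B,C,D,E,F,G,H,K,1$, respectively, on level $n$ of the hyperbolic Pascal simplex based on the hypercube mosaic $\{4,3,3,5\}$. Then for all $n\ge1$ $$\begin{aligned} \hat a_{n+1}&=2\hat a_n+2\hat b_n+3\hat v_n,\\ \hat b_{n+1}&=\hat a_n+2\hat b_n,\\ \hat c_{n+1}&=2\hat a_n+3\hat c_n+2\hat d_n,\\ \hat d_{n+1}&=2\hat b_n+3\hat c_n+4\hat d_n+5\hat e_n,\\ \hat e_{n+1}&=3\hat c_n+4\hat d_n+6\hat e_n,\\ \hat f_{n+1}&=\hat c_n+4\hat f_n+2\hat g_n,\\ \hat g_{n+1}&=\hat d_n+6\hat f_n+6\hat g_n+5\hat h_n,\\ \hat h_{n+1}&=\hat e_n+12\hat f_n+12\hat g_n+12\hat h_n+12\hat k_n,\\ \hat k_{n+1}&=94\hat f_n+97\hat g_n+101\hat h_n+107\hat k_n,\\ \hat v_{n+1}&=\hat v_n, \end{aligned}$$ with initial values $\hat v_1=4$ and $\hat a_1=\hat b_1=\hat c_1=\hat d_1=\hat e_1=\hat f_1=\hat g_1=\hat h_1=\hat k_1=0$.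
   Context: The mosaic $\{4,3,3,5\}$ is the regular tessellation of hyperbolic 4-space by 4-dimensional hypercubes $\{4,3,3\}$ with vertex figure the 600-cell $\{3,3,5\}$ (so 600 hypercubes and 120 edges meet at each vertex). Hyperbolic Pascal simplex. Fix a vertex $V_0$ of the mosaic. The value (sign) of a vertex is the number of shortest paths along mosaic edges from $V_0$ to that vertex (the value of $V_0$ is $1$). Define a convex part $\mathcal P$ of the mosaic as follows. Take one hypercube containing $V_0$ and let $V_1$ be its vertex opposite to $V_0$ (the vertex of this hypercube with the largest value, namely $24$). Next take all new hypercubes of the mosaic containing $V_1$, and in each of them the vertex with the largest value. Then take all hypercubes containing these vertices, and in each new one the vertex with the largest value, and so on without end. $\mathcal P$ is the set of all hypercubes obtained. The vertices and edges of $\mathcal P$, with each edge directed from its endpoint nearer to $V_0$ to its endpoint farther from $V_0$, form an infinite digraph called the hyperbolic Pascal simplex. Level $n$ is the set of its vertices whose edge-distance from $V_0$ along edges of $\mathcal P$ is $n$. An incoming edge of a vertex on level $n$ is an edge from a vertex on level $n-1$; the value of a vertex other than $V_0$ is the sum of the values of the starting points of its incoming edges. Vertex types. The boundary of $\mathcal P$ has the combinatorial shape of an infinite simplicial cone with apex $V_0$: four boundary rays, six 2-dimensional faces and four 3-dimensional faces. - Type $1$: vertices on the boundary rays (value $1$). They have degree $5$ in $\mathcal P$, except $V_0$, which has degree $4$. - Types $A$, $B$: vertices in the interior of a 2-dimensional face (degree $7$ in $\mathcal P$), with exactly two (type $A$) or one (type $B$) incoming edges. - Types $C$, $D$, $E$: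 vertices in the interior of a 3-dimensional face (degree $13$ in $\mathcal P$), with exactly three (type $C$), two (type $D$) or one (type $E$) incoming edges. - Types $F$, $G$, $H$, $K$: vertices in the interior of $\mathcal P$ (degree $120$), with exactly four (type $F$), three (type $G$), two (type $H$) or one (type $K$) incoming edges.
   Formalization: The stated iteration for the convex part reaches only 40 of the 600 hypercubes at some type K vertices, contradicting degree 120; here the part is also closed under convexity: if it contains three hypercubes around a 2-dimensional cell, it contains all five. *)

(* Defs.v *)
From mathcomp Require Import all_boot all_order all_algebra finmap.
From mathcomp Require Import boolp classical_sets cardinality fsbigop.
From mathcomp Require Import reals trigo.

Set Implicit Arguments.
Unset Strict Implicit.
Unset Printing Implicit Defensive.

Import Order.TTheory GRing.Theory Num.Theory.

Local Open Scope classical_set_scope.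
Local Open Scope ring_scope.

Section Graph.
Variables (T : choiceType) (E : T -> T -> Prop).

Definition walk (x : T) (p : seq T) (y : T) : Prop :=
  path (fun u v => `[< E u v >]) x p /\ last x p = y.

(* A path from [x] is the sequence of its successive vertices, [x] excluded,
   so that [size p] is its number of edges. *)
Definition shortest_paths (x y : T) : set (seq T) :=
  [set p | walk x p y /\ forall q, walk x q y -> (size p <= size q)%N].

Definition at_distance (x : T) (n : nat) : set T :=
  [set y | exists2 p, shortest_paths x y p & size p = n].

End Graph.

Section Mosaic.
Variable R : realType.

(* The mosaic is obtained by Wythoff's construction from the Coxeter group
   [4,3,3,5].  Let B be the bilinear form on R^5 whose Gram matrix on a basis
   a_0, ..., a_4 is [gram] below; it has signature (4,1), and the lines in its
   negative cone are the points of hyperbolic 4-space.  The mirrors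
   a_0^perp, ..., a_4^perp bound the characteristic simplex of the mosaic, with
   dihedral angles pi / m_ij.  A vector x is represented here by the row of the
   B(x, a_i): the simplex is the positive orthant, its vertices are the unit
   rows, and the reflection x - 2 B(x, a_i) a_i becomes [reflection]. *)
Definition schlafli : seq nat := [:: 4; 3; 3; 5]%N.

Definition coxeter_mx (i j : 'I_5) : nat :=
  (if i == j then 1
   else if (i.+1 == j) || (j.+1 == i) then nth 2 schlafli (minn i j)
   else 2)%N.

Definition gram : 'M[R]_5 := \matrix_(i, j) - cos (pi / (coxeter_mx i j)%:R).

Definition reflection (i : 'I_5) (x : 'rV[R]_5) : 'rV[R]_5 :=
  x - (2 * x 0 i) *: row i gram.

(* A k-dimensional cell is represented by its centre: the vertex of the
   characteristic simplex opposite to the mirror of a_k is the centre of the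
   k-dimensional cell of the base flag, and [flag w] is the image of that flag
   under the product of reflections spelled by [w].  Each centre is the same
   vector for all the flags that contain the cell. *)
Definition flag (w : seq 'I_5) (k : nat) : 'rV[R]_5 :=
  foldr reflection (\row_(j < 5) (j == k :> nat)%:R) w.

Definition incident (j k : nat) (x y : 'rV[R]_5) : Prop :=
  exists w, x = flag w j /\ y = flag w k.

Definition mosaic_adj (x y : 'rV[R]_5) : Prop :=
  x <> y /\ exists e, incident 0 1 x e /\ incident 0 1 y e.

Definition value (V0 x : 'rV[R]_5) : nat :=
  #|` fset_set (shortest_paths mosaic_adj V0 x)|.

Definition largest_vertex (V0 C x : 'rV[R]_5) : Prop :=
  incident 0 4 x C /\
  forall y, incident 0 4 y C -> (value V0 y <= value V0 x)%N.

End Mosaic.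

Section PascalSimplex.
Variables (R : realType) (V0 C0 : 'rV[R]_5).
Implicit Types (x y z C : 'rV[R]_5).

(* The last rule makes the part convex.  The dihedral angle of the hypercubes
   is 2 pi / 5, so three of the five hypercubes around a 2-dimensional cell
   span more than pi and a convex part that contains them contains all five.
   The first two rules alone leave re-entrant holes: for instance only 40 of
   the 600 hypercubes at an inner vertex with one incoming edge are reached. *)
Inductive in_simplex : 'rV[R]_5 -> Prop :=
| in_simplex_first : in_simplex C0
| in_simplex_step C x C' :
    in_simplex C -> largest_vertex V0 C x -> incident 0 4 x C' ->
    in_simplex C'
| in_simplex_convex z C1 C2 C3 C :
    in_simplex C1 -> in_simplex C2 -> in_simplex C3 ->
    C1 <> C2 -> C1 <> C3 -> C2 <> C3 ->
    incident 2 4 z C1 -> incident 2 4 z C2 -> incident 2 4 z C3 ->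
    incident 2 4 z C -> in_simplex C.

Definition simplex_adj (x y : 'rV[R]_5) : Prop :=
  x <> y /\
  exists e, [/\ exists2 C, in_simplex C & incident 1 4 e C,
                incident 0 1 x e & incident 0 1 y e].

Definition level (n : nat) : set 'rV[R]_5 := at_distance simplex_adj V0 n.

Definition incoming (x : 'rV[R]_5) : set 'rV[R]_5 :=
  [set y | simplex_adj y x /\ exists n, level n y /\ level n.+1 x].

Definition indegree (x : 'rV[R]_5) : nat := #|` fset_set (incoming x)|.

(* As in a corner of the cubic lattice, the k-dimensional faces of the cone
   (k = 1, 2, 3) are tiled by the k-dimensional cells that belong to a single
   hypercube of the part: a cell of the same dimension in the interior of a
   face of larger dimension, or of the part, belongs to several. *)
Definition on_face (k : nat) (x : 'rV[R]_5) : Prop :=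
  exists2 z, incident 0 k x z & exists! C, in_simplex C /\ incident k 4 z C.

Variant vertex_type : Type :=
  | T1 | TA | TB | TC | TD | TE | TF | TG | TH | TK.

Definition has_type (t : vertex_type) : set 'rV[R]_5 :=
  let face2 x := on_face 2 x /\ ~ on_face 1 x in
  let face3 x := on_face 3 x /\ ~ on_face 2 x in
  let inner x := ~ on_face 3 x in
  match t with
  | T1 => [set x | on_face 1 x]
  | TA => [set x | face2 x /\ indegree x = 2]
  | TB => [set x | face2 x /\ indegree x = 1]
  | TC => [set x | face3 x /\ indegree x = 3]
  | TD => [set x | face3 x /\ indegree x = 2]
  | TE => [set x | face3 x /\ indegree x = 1]
  | TF => [set x | inner x /\ indegree x = 4]
  | TG => [set x | inner x /\ indegree x = 3]
  | TH => [set x | inner x /\ indegree x = 2]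
  | TK => [set x | inner x /\ indegree x = 1]
  end%N.

Definition value_sum (t : vertex_type) (n : nat) : nat :=
  \big[addn/0%N]_(x \in level n `&` has_type t) value V0 x.

End PascalSimplex.

(* Main.v *)
(** The 120 reflections that exchange V0 with its neighbours generate a
    right-angled Coxeter group, simply transitive on the vertices of the mosaic;
    they are indexed by the vertices of the 600-cell, and two of them commute
    exactly when these vertices are adjacent.  A vertex is thus a group element,
    its distance to V0 is the word length, its incoming edges are its right
    descents, which form a clique D, and its value is the number of its reduced
    words.  Appending a letter u outside D changes D into {u} together with the
    neighbours of u in D.

    The part consists of the elements such that, for each of the four directions
    x of C0, either x is a left descent or all the letters are neighbours of x.
    The directions of the second kind form a clique S, the link of the part at
    the vertex is the star of S, and the type of the vertex is given by
    (|D|, |S|).  Counting reduced words by their last letter, the recurrences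
    amount to counting the letters of the star of S outside D by the type of the
    successor; as the symmetries of the 600-cell are transitive on ordered
    cliques, this is a finite computation. *)

Require Import Defs.
From HB Require Import structures.
From mathcomp Require Import boolp classical_sets cardinality fsbigop.
From mathcomp Require Import all_boot all_order all_algebra finmap.
From mathcomp Require Import reals trigo.
From mathcomp Require Import ring lra zify.

Set Implicit Arguments.
Unset Strict Implicit.
Unset Printing Implicit Defensive.

Import Order.TTheory GRing.Theory Num.Theory.

(** * The 600-cell *)

(** Two of the 120 mirrors are orthogonal when the edges that they bisect span a square; any other
    two pair to at most -1 and do not meet. This gap is all the geometry that the word combinatorics
    needs. Reduced words and descents are controlled by linear functionals. Along a word, the values
    f u of a functional at the images of the roots change to f u - 2 * pr t (rt u) * f t when t is
    fired, and a two-part inequality survives every ascending letter. Applied to a height, it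
    detects descents and shows that the action is free; applied to the pairing with a fixed root, it
    tells on which side of a mirror a vertex lies. The main obstacle is the part itself: it is
    generated by largest vertices and convexity, while counting needs a membership test at each
    vertex. Nothing generated crosses the boundary because a triangle of the 600-cell lies in only
    two tetrahedra; everything inside is generated because the star of S can be filled from one
    incoming direction. All finite checks are exact: once sqrt 2 is split off, the coordinates of
    the roots lie in Z[phi]. *)

(* The pair (a, b) is the number a + b phi, with phi = (1 + sqrt 5) / 2. *)
Definition zphi : Type := int * int.

Definition zphi_mul (x y : zphi) : zphi :=
  (x.1 * y.1 + x.2 * y.2, x.1 * y.2 + x.2 * y.1 + x.2 * y.2)%R.

Definition zphi_phi (x : zphi) : zphi := (x.2, x.1 + x.2)%R.

(* (z1, z2, z3, z4) is the root a_0 + sqrt 2 * (z1 a_1 + ... + z4 a_4), and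
   [root_refl i] is the reflection in a_i. *)
Definition root4 : Type := zphi * zphi * zphi * zphi.

Definition root_refl (i : nat) (z : root4) : root4 :=
  let: (z1, z2, z3, z4) := z in
  match i with
  | 1 => ((1, 0) - z1 + z2, z2, z3, z4)
  | 2 => (z1, z1 - z2 + z3, z3, z4)
  | 3 => (z1, z2, z2 - z3 + zphi_phi z4, z4)
  | 4 => (z1, z2, z3, zphi_phi z3 - z4)
  | _ => z
  end%R.

(** The bilinear form on two roots: after the factors sqrt 2 of the coordinates are absorbed, the
    Gram entries 1, - sqrt 2 / 2, - 1 / 2 and - phi / 2 contribute 2, -1, -1 and - phi, so only phi
    remains irrational. *)
Definition root_form (y z : root4) : zphi :=
  let: (y1, y2, y3, y4) := y in let: (z1, z2, z3, z4) := z in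
  let m := zphi_mul in
  ((1, 0) - y1 - z1 + (m y1 z1 + m y2 z2 + m y3 z3 + m y4 z4) *+ 2
   - (m y1 z2 + m y2 z1) - (m y2 z3 + m y3 z2)
   - zphi_phi (m y3 z4 + m y4 z3))%R.

Fixpoint root_orbit (fuel : nat) (found todo : seq root4) : seq root4 :=
  if fuel is n.+1 then
    if todo is z :: todo' then
      let new := [seq y <- undup [seq root_refl i z | i <- iota 1 4]
                 | y \notin found] in
      root_orbit n (found ++ new) (todo' ++ new)
    else found
  else found.

Definition root0 : root4 := (0, 0, 0, 0)%R.

Definition roots : seq root4 :=
  Eval vm_compute in root_orbit 200 [:: root0] [:: root0].

Definition refl_table : seq (seq nat) :=
  Eval vm_compute in
  [seq [seq index (root_refl i z) roots | z <- roots] | i <- iota 0 5].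

Definition adj_table : seq (seq nat) :=
  Eval vm_compute in
  [seq [seq j <- iota 0 120 | root_form y (nth root0 roots j) == 0%R]
  | y <- roots].


Definition refln (i n : nat) : nat := nth 0 (nth [::] refl_table i) n.

Definition adjn (m n : nat) : bool := n \in nth [::] adj_table m.

(* [found] pairs each point of the orbit with a word that carries the starting
   point to it. *)
Fixpoint orbit_words (gens : seq nat) (fuel : nat) (found todo : seq (nat * seq nat)) :=
  if fuel is n.+1 then
    if todo is (x, w) :: todo' then
      let new := [seq y <- [seq (refln i x, i :: w) | i <- gens]
                 | y.1 \notin unzip1 found] in
      let new := [seq y <- new | (find (fun z => z.1 == y.1) new) == index y new] in
      orbit_words gens n (found ++ new) (todo' ++ new)
    else found
  else found.

Definition word_table : seq (seq (nat * seq nat)) :=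
  Eval vm_compute in
  [seq orbit_words (iota k.+1 (4 - k)) 121 [:: (k, [::])] [:: (k, [::])]
  | k <- iota 0 4].

(** A certificate that [rest] is built up by triangles, each new vertex closing one on an edge of
    earlier vertices; a property stable under completing triangles then spreads along the list. *)
Fixpoint spread_ok (prev rest : seq nat) : bool :=
  if rest is r :: rest' then
    let near := filter (adjn r) prev in
    has (fun q => has (adjn q) near) near && spread_ok (r :: prev) rest'
  else true.


(** The finite checks run on bare natural numbers, free of ordinal proofs; this lemma and the next
    carry the results to ordinals. *)
Lemma all_ltn n (P : pred nat) : all P (iota 0 n) -> forall u : 'I_n, P u.
Proof. by move=> /allP h u; apply: h; rewrite mem_iota /=. Qed.

Lemma card_count n (P : pred nat) :
  #|[pred u : 'I_n | P u]| = count P (iota 0 n).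
Proof.
rewrite cardE -val_enum_ord count_map -size_filter /enum_mem -enumT /=.
by rewrite -filter_predI; congr size; apply: eq_filter => u; rewrite /= andbT.
Qed.

(* A definition rather than a notation, so that the numeral stays folded. *)
Definition V600 : Type := 'I_120.
HB.instance Definition _ := Finite.copy V600 'I_120.

(** * Symmetries of the 600-cell *)

Section Graph600.
Implicit Types (u v x y : V600) (s : seq V600) (A B C : {set V600}) (h g : seq 'I_5).

Definition adj : rel V600 := fun u v => adjn u v.

(** Generator 0 falls into the default branch of [root_refl] and is the identity here, although in
    space it moves the base vertex. Words that serve as symmetries of the 600-cell therefore avoid
    [ord0]. *)
Definition rf (i : 'I_5) (u : V600) : V600 := inord (refln i u).

Definition rfs (h : seq 'I_5) (u : V600) : V600 := foldr rf u h.

Lemma rf_tables (i : 'I_5) (u : V600) :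
  [/\ (refln i u < 120)%N, refln i (refln i u) = u
    & all (adjn (refln i u)) (map (refln i) (nth [::] adj_table u))].
Proof.
have : all (fun i : nat => all (fun u : nat => [&& (refln i u < 120)%N,
    refln i (refln i u) == u
    & all (adjn (refln i u)) (map (refln i) (nth [::] adj_table u))])
  (iota 0 120)) (iota 0 5) by vm_compute.
by move=> /all_ltn/(_ i)/all_ltn/(_ u)/and3P[? /eqP ? ?].
Qed.

Lemma val_rf i u : rf i u = refln i u :> nat.
Proof. by rewrite /rf inordK //; case: (rf_tables i u). Qed.

Lemma rfK i : involutive (rf i).
Proof. by move=> u; apply: val_inj; rewrite /= !val_rf; case: (rf_tables i u). Qed.

Lemma adj_tables (u v : V600) : ~~ adj u u /\ (adj u v -> adj v u).
Proof.
have : all (fun u : nat => ~~ adjn u u && all (adjn^~ u) (nth [::] adj_table u))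
  (iota 0 120) by vm_compute.
by move=> /all_ltn/(_ u)/andP[? /allP h]; split=> // /h.
Qed.

Lemma adjxx u : adj u u = false.
Proof. by apply/negbTE; case: (adj_tables u u). Qed.

Lemma adjC u v : adj u v = adj v u.
Proof. by apply/idP/idP; case: (adj_tables u v); case: (adj_tables v u); auto. Qed.

Lemma adj_neq u v : adj u v -> u != v.
Proof. by apply: contraTneq => ->; rewrite adjxx. Qed.

Lemma adj_rf i u v : adj (rf i u) (rf i v) = adj u v.
Proof.
suff h x y : adj x y -> adj (rf i x) (rf i y).
  by apply/idP/idP => [/h|/h //]; rewrite !rfK.
move=> xy; rewrite /adj !val_rf; case: (rf_tables i x) => _ _ /allP; apply.
exact: map_f.
Qed.

Lemma rfs_cat h h' u : rfs (h ++ h') u = rfs h (rfs h' u).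
Proof. by rewrite /rfs foldr_cat. Qed.

Lemma rfs_rev h : cancel (rfs h) (rfs (rev h)).
Proof.
elim: h => [|i h ih] u //=.
by rewrite rev_cons -cats1 rfs_cat /= rfK ih.
Qed.

Lemma rfs_revK h : cancel (rfs (rev h)) (rfs h).
Proof. by move=> u; rewrite -{1}[h]revK rfs_rev. Qed.

Lemma rfs_inj h : injective (rfs h). Proof. exact: can_inj (rfs_rev h). Qed.

Lemma adj_rfs h u v : adj (rfs h u) (rfs h v) = adj u v.
Proof. by elim: h => //= i h; rewrite adj_rf. Qed.

(** The search that lists the roots meets r_k ... r_1 a_0 in position k for k <= 3. These four are
    pairwise orthogonal, and generator i fixes the j-th of them when j + 1 < i. *)
Definition base : seq V600 := [seq inord k | k <- iota 0 4].

Lemma size_base : size base = 4. Proof. by []. Qed.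

Lemma base_clique : pairwise adj base.
Proof. by rewrite /base /= /adj !inordK. Qed.

Lemma nth_base k : (k < 4)%N -> nth ord0 base k = k :> nat.
Proof.
move=> hk; rewrite (nth_map 0) ?size_iota // nth_iota // add0n inordK //.
exact: leq_trans hk _.
Qed.

(** One link of a stabilizer chain: the generators above k fix the first k base vertices, and they
    move the next one to all common neighbours of these (120, 12, 5, 2 of them for k = 0, 1, 2, 3).
    The words in [word_table] are the witnesses. *)
Lemma base_stabilizer_trans k (v : V600) :
  (k < 4)%N -> all (adj v) (take k base) ->
  exists h, [/\ ord0 \notin h, rfs h (nth ord0 base k) = v
    & map (rfs h) (take k base) = take k base].
Proof.
move=> k4 hv.
have : all (fun k => all (fun v : nat => all (adjn v) (iota 0 k) ==>
    has (fun xw => [&& foldr refln k xw.2 == v, all (leq k.+1) xw.2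
      & all (geq 4) xw.2]) (nth [::] word_table k)) (iota 0 120)) (iota 0 4)
  by vm_compute.
move=> /all_ltn/(_ (Ordinal k4))/all_ltn/(_ v) /=.
have -> : all (adjn v) (iota 0 k).
  apply/allP => j; rewrite mem_iota add0n => /= jk.
  have := allP hv (nth ord0 base j).
  rewrite /adj nth_base ?(ltn_trans jk) //; apply.
  by rewrite -(nth_take _ jk) mem_nth // size_take size_base k4.
move=> /hasP[[x w] _ /= /and3P[/eqP wv wk w4]].
exists (map inord w); split.
- apply/mapP => -[i iw /(congr1 val)]; have i5 : (i < 5)%N := allP w4 i iw.
  rewrite /= inordK // => i0.
  by have := allP wk _ iw; rewrite -i0.
- apply: val_inj; rewrite [RHS]/= -wv; elim: w w4 {wk wv} => [|i w ih] /=.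
    by rewrite nth_base.
  by move=> /andP[i4 /ih <-]; rewrite val_rf (@inordK 4).
- have fix_ : all (fun k => all (fun j => all (fun i => refln i j == j)
      (iota k.+1 (4 - k))) (iota 0 k)) (iota 0 4) by vm_compute.
  apply: (@eq_from_nth _ ord0) => [|j]; rewrite size_map // => jk.
  rewrite (nth_map ord0) //; move: jk; rewrite size_take size_base k4 => jk.
  rewrite nth_take //; elim: w wk w4 {wv} => [//|i w ih] /=.
  move=> /andP[ki wk] /andP[i4 w4]; rewrite ih //; apply: val_inj => /=.
  rewrite val_rf (@inordK 4) // nth_base ?(ltn_trans jk) //.
  have /allP/(_ j) := all_ltn fix_ (Ordinal k4); rewrite mem_iota /= add0n jk.
  move=> /(_ isT)/allP/(_ i); rewrite mem_iota => h; apply/eqP/h.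
  by rewrite ki /=; lia.
Qed.

(** Climbs the stabilizer chain: the word found for the shorter clique is undone on the new vertex,
    which becomes a common neighbour of base vertices. *)
Lemma clique_trans (s : seq V600) :
  pairwise adj s -> (size s <= 4)%N ->
  exists2 h, ord0 \notin h & s = map (rfs h) (take (size s) base).
Proof.
elim/last_ind: s => [|s v ih]; first by exists [::].
rewrite size_rcons -cats1 pairwise_cat allrel1r => /and3P[sv ss _] s4.
have [h h0 sE] := ih ss (ltnW s4).
have [|g [g0 gv gb]] := @base_stabilizer_trans (size s) (rfs (rev h) v) s4.
  apply/allP => u ub; rewrite -(adj_rfs h) rfs_revK adjC.
  by apply: (allP sv); rewrite sE map_f.
exists (h ++ g); first by rewrite mem_cat negb_or h0.
rewrite (take_nth ord0) ?size_base // map_rcons rfs_cat gv rfs_revK -cats1.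
congr (_ ++ _); rewrite {1}sE -{1}gb -map_comp; apply: eq_map => u /=.
by rewrite rfs_cat.
Qed.

(** * Cliques of the 600-cell and their extensions *)

Definition cliq (A : {set V600}) : bool :=
  [forall u in A, forall v in A, (u != v) ==> adj u v].

Lemma cliqP A :
  reflect {in A &, forall u v, u != v -> adj u v} (cliq A).
Proof.
apply: (iffP forall_inP) => [h u v /h /forall_inP h' /h' /implyP //|h u uA].
by apply/forall_inP => v vA; apply/implyP; apply: h.
Qed.

Lemma pairwise_uniq_adj s : pairwise adj s -> uniq s.
Proof. by move=> h; apply: (pairwise_uniq adjxx). Qed.

Lemma cliq_seq s : pairwise adj s -> cliq [set x in s].
Proof.
move=> ss; apply/cliqP => u v; rewrite !inE.
elim: s ss => //= x s ih /andP[/allP xs ss]; rewrite !inE.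
move=> /orP[/eqP->|us] /orP[/eqP->|vs]; rewrite ?eqxx //.
- by rewrite xs.
- by rewrite adjC xs.
- exact: ih.
Qed.

Lemma cliq_enum A : cliq A -> pairwise adj (enum A).
Proof.
move=> /cliqP h; have := enum_uniq A.
have : {subset enum A <= A} by move=> x; rewrite mem_enum.
elim: (enum A) => //= x s ih sA /andP[xs us].
rewrite ih ?andbT //; last by move=> y ys; apply: sA; rewrite inE ys orbT.
apply/allP => y ys; apply: h; rewrite ?sA ?inE ?eqxx ?ys ?orbT //.
by apply: contraNneq xs => ->.
Qed.

Lemma cliq_sub A B : A \subset B -> cliq B -> cliq A.
Proof.
by move=> /subsetP AB /cliqP h; apply/cliqP => u v /AB uB /AB; apply: h.
Qed.

Lemma cliq_setU1 A u : cliq A -> {in A, forall v, adj u v} -> cliq (u |: A).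
Proof.
move=> /cliqP h uA; apply/cliqP => x y; rewrite !inE.
move=> /orP[/eqP->|xA] /orP[/eqP->|yA]; rewrite ?eqxx // => xy.
- exact: uA.
- by rewrite adjC uA.
- exact: h.
Qed.

Lemma base_extensions k : (k <= 4)%N ->
  if k == 4 then #|[pred u | all (adj u) (take k base)]| = 0
  else (2 <= #|[pred u | all (adj u) (take k base)]|)%N.
Proof.
move=> k4.
have -> : #|[pred u | all (adj u) (take k base)]|
    = count (fun n => all (adjn n) (iota 0 k)) (iota 0 120).
  rewrite -card_count; apply: eq_card => u; rewrite !inE.
  have -> : iota 0 k = map val (take k base).
    apply: (@eq_from_nth _ 0) => [|j].
      by rewrite size_map size_iota size_takel ?size_base.
    rewrite size_iota => jk; rewrite nth_iota // (nth_map ord0).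
      by rewrite nth_take //= nth_base ?add0n //; apply: leq_trans jk k4.
    by rewrite size_takel ?size_base.
  by rewrite all_map.
have : all (fun k => let c := count (fun n => all (adjn n) (iota 0 k)) (iota 0 120)
    in if k == 4 then c == 0 else (1 < c)%N) (iota 0 5) by vm_compute.
move=> /allP/(_ k); rewrite mem_iota /= ltnS => /(_ k4).
by case: ifP => // _ /eqP.
Qed.

Lemma clique_extensions (s : seq V600) : pairwise adj s -> (size s <= 4)%N ->
  if size s == 4 then forall u, ~~ all (adj u) s
  else exists u v, [/\ u != v, all (adj u) s & all (adj v) s].
Proof.
move=> ss s4; have [h _ sE] := clique_trans ss s4.
have tr u : all (adj (rfs h u)) s = all (adj u) (take (size s) base).
  by rewrite {1}sE all_map; apply: eq_all => x /=; rewrite adj_rfs.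
have := base_extensions s4; case: ifP => _.
  move=> /card0_eq h0 u; rewrite -(rfs_revK h u) tr.
  by have := h0 (rfs (rev h) u); rewrite !inE => ->.
move=> /card_gt1P[u [v [hu hv uv]]]; exists (rfs h u), (rfs h v).
by rewrite (inj_eq (@rfs_inj h)) !tr.
Qed.

Lemma clique_size s : pairwise adj s -> (size s <= 4)%N.
Proof.
move=> ss; rewrite leqNgt; apply/negP => s4.
have sz : size (drop 1 (take 5 s)) = 4 by rewrite size_drop size_takel.
have : pairwise adj (take 5 s) by move: ss; rewrite -{1}(cat_take_drop 5 s) pairwise_cat => /and3P[].
case: (take 5 s) sz => [//|x t]; rewrite /= drop0 => tz /andP[xt tt].
by have := clique_extensions tt; rewrite tz => /(_ isT)/(_ x); rewrite xt.
Qed.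

Lemma cliq_card A : cliq A -> (#|A| <= 4)%N.
Proof. by move=> /cliq_enum/clique_size; rewrite -cardE. Qed.

Lemma cliq_ext A : cliq A -> (#|A| < 4)%N ->
  exists u v, [/\ u != v, {in A, forall x, adj u x} & {in A, forall x, adj v x}].
Proof.
move=> cA A4; have := clique_extensions (cliq_enum cA).
rewrite -cardE (ltn_eqF A4) => /(_ (ltnW A4))[u [v [uv uA vA]]].
by exists u, v; split=> // x; rewrite -mem_enum; [apply: (allP uA)|apply: (allP vA)].
Qed.

Lemma cliq_max A u : cliq A -> #|A| = 4 -> {in A, forall x, adj u x} -> False.
Proof.
move=> cA A4 uA; have := cliq_card (cliq_setU1 cA uA).
rewrite cardsU1 A4; case: (boolP (u \in A)) => // /uA.
by rewrite adjxx.
Qed.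

Lemma cliq_complete A : cliq A -> exists B, [/\ A \subset B, cliq B & #|B| = 4].
Proof.
move: {2}(4 - #|A|) (erefl (4 - #|A|)) => n.
elim: n A => [|n ih] A nA cA.
  by exists A; split=> //; have := cliq_card cA; lia.
have [u [_ [_ uA _]]] : exists u v, [/\ u != v, {in A, forall x, adj u x}
    & {in A, forall x, adj v x}] by apply: cliq_ext => //; lia.
have uNA : u \notin A by apply/negP => /uA; rewrite adjxx.
have [||B [AB cB B4]] := ih (u |: A); last exists B.
- by rewrite cardsU1 uNA; lia.
- exact: cliq_setU1.
by split=> //; apply: subset_trans AB; apply: subsetUr.
Qed.

Lemma cliq_complete2 A : cliq A -> (#|A| < 4)%N ->
  exists B C, [/\ B != C, A \subset B /\ A \subset C, cliq B /\ cliq C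
    & #|B| = 4 /\ #|C| = 4].
Proof.
move=> cA A4; have [B [AB cB B4]] := cliq_complete cA.
(* Dropping from a tetrahedron a vertex outside A leaves a triangle above A, and a triangle lies in
   two tetrahedra. *)
have [b bB bA] : exists2 b, b \in B & b \notin A.
  apply/subsetPn; apply: contraTN A4 => BA; rewrite -leqNgt.
  by apply: leq_trans (subset_leq_card BA); rewrite B4.
have AB' : A \subset B :\ b by rewrite subsetD1 AB bA.
have cB' : cliq (B :\ b) by apply: cliq_sub cB; apply: subD1set.
have B3 : #|B :\ b| = 3 by apply/eqP; rewrite -eqSS -B4 (cardsD1 b B) bB.
have [u [v [uv uB vB]]] := cliq_ext cB' ltac:(by rewrite B3).
have fresh x : {in B :\ b, forall y, adj x y} -> x \notin B :\ b.
  by move=> h; apply/negP => /h; rewrite adjxx.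
exists (u |: B :\ b), (v |: B :\ b); split.
- apply: contraNneq (fresh _ uB) => e.
  have : u \in v |: B :\ b by rewrite -e setU11.
  by rewrite in_setU1 (negbTE uv).
- by split; apply: subset_trans AB' _; apply: subsetUr.
- by split; apply: cliq_setU1.
- by rewrite !cardsU1 !fresh // B3.
Qed.

(** In the mosaic: three hypercubes never share a 3-dimensional cell. This keeps the convexity rule
    from crossing the boundary of the part. *)
Lemma cliq3_ext A u v w : cliq A -> #|A| = 3 ->
  {in A, forall x, adj u x} -> {in A, forall x, adj v x} ->
  {in A, forall x, adj w x} -> u != v -> u != w -> v != w -> False.
Proof.
move=> cA A3 uA vA wA uv uw vw; have ss := cliq_enum cA.
have s3 : size (enum A) = 3 by rewrite -cardE.
have [|h _ sE] := clique_trans ss; first by rewrite s3.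
have c2 : #|[pred u | all (adj u) (take 3 base)]| = 2.
  have -> : #|[pred u | all (adj u) (take 3 base)]|
      = count (fun n => all (adjn n) (iota 0 3)) (iota 0 120).
    by rewrite -card_count; apply: eq_card => x; rewrite !inE /= /adj !inordK.
  by vm_compute.
have in2 x : {in A, forall y, adj x y} -> rfs (rev h) x \in [pred u | all (adj u) (take 3 base)].
  move=> xA; rewrite inE; apply/allP => y yb; rewrite -(adj_rfs h) rfs_revK.
  by apply: xA; rewrite -mem_enum sE map_f // s3.
have : (2 < #|[pred u | all (adj u) (take 3 base)]|)%N.
  apply/card_gt2P; exists (rfs (rev h) u), (rfs (rev h) v), (rfs (rev h) w).
  by rewrite !in2 // !(inj_eq (@rfs_inj _)) uv vw eq_sym uw.
by rewrite c2.
Qed.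

(** * Propagation over triangles and tetrahedra *)

Lemma spread_okP (Q : pred nat) (prev rest : seq nat) :
  spread_ok prev rest -> all Q prev ->
  (forall q q' r, q \in prev ++ rest -> q' \in prev ++ rest -> r \in prev ++ rest ->
     adjn q q' -> adjn r q -> adjn r q' -> Q q -> Q q' -> Q r) ->
  all Q rest.
Proof.
elim: rest prev => [//|r rest ih] prev /= /andP[/hasP[q]].
rewrite mem_filter => /andP[rq qp] /hasP[q']; rewrite mem_filter.
move=> /andP[rq' qp'] qq' ok Qp cl.
have Qr : Q r.
  apply: (cl q q') => //; rewrite ?mem_cat ?qp ?qp' ?inE ?eqxx ?orbT //.
  - exact: (allP Qp).
  - exact: (allP Qp).
rewrite Qr /=; apply: ih ok _ _ => /=; first by rewrite Qr.
have e (y : nat) : (y \in (r :: prev) ++ rest) = (y \in prev ++ r :: rest).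
  by rewrite !(mem_cat, inE); case: (y == r); rewrite ?orbT.
by move=> x y z; rewrite !e; apply: cl.
Qed.

(** The certificate is computed once, on the edge {0, 1}, and carried to the edge {p, p'} by a
    symmetry. *)
Lemma spread_all (Q : pred V600) p p' :
  adj p p' -> Q p -> Q p' ->
  (forall q q' r, adj q q' -> adj r q -> adj r q' -> Q q -> Q q' -> Q r) ->
  forall r, Q r.
Proof.
move=> pp Qp Qp' cl r.
have [|//|h _ [pE p'E]] := @clique_trans [:: p; p']; first by rewrite /= pp.
have Q0 : spread_ok [:: 1; 0] (iota 2 118) by vm_compute.
pose Q' (n : nat) := Q (rfs h (inord n)).
have : all Q' (iota 2 118).
  apply: spread_okP Q0 _ _ => [|x y z]; first by rewrite /= /Q' -pE -p'E Qp Qp'.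
  have lt n : n \in [:: 1; 0] ++ iota 2 118 -> (n < 120)%N.
    by rewrite mem_cat mem_iota !inE; lia.
  move=> /lt xl /lt yl /lt zl xy zx zy; apply: cl; rewrite adj_rfs /adj !inordK //.
move=> /allP Q2; rewrite -(rfs_revK h r); set k := rfs (rev h) r.
have [k0|[k1|k2]] : k = inord 0 \/ k = inord 1 \/ (1 < k)%N.
- case: (ltnP 1 k) => [|k1]; first by right; right.
  case: (posnP k) => k0; [left|right; left]; rewrite -[LHS]inord_val.
    by rewrite k0.
  by congr inord; apply/eqP; rewrite eqn_leq k1.
- by rewrite k0 -pE.
- by rewrite k1 -p'E.
- have := Q2 k; rewrite /Q' inord_val; apply; rewrite mem_iota k2 /=.
  exact: ltn_ord.
Qed.

(** The same inside the link of x, an icosahedron. The row of vertex 0 starts with 1 and 2, which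
    are carried to p and p'; the ten other neighbours remain. *)
Lemma spread_link (Q : pred V600) x p p' :
  adj x p -> adj x p' -> adj p p' -> Q p -> Q p' ->
  (forall q q' r, adj x q -> adj x q' -> adj x r ->
     adj q q' -> adj r q -> adj r q' -> Q q -> Q q' -> Q r) ->
  forall r, adj x r -> Q r.
Proof.
move=> xp xp' pp Qp Qp' cl r xr.
have [|//|h _ [xE pE p'E]] := @clique_trans [:: x; p; p'].
  by rewrite /= xp xp' pp.
pose nb0 := drop 2 (nth [::] adj_table 0).
have Q0 : spread_ok [:: 2; 1] nb0 by vm_compute.
have nb0E : all (fun n => (n < 120)%N && adjn 0 n) ([:: 2; 1] ++ nb0) by vm_compute.
have i0 : rfs h (inord 0) = x by [].
pose Q' (n : nat) := Q (rfs h (inord n)).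
have : all Q' nb0.
  apply: spread_okP Q0 _ _ => [|a b c]; first by rewrite /= /Q' -pE -p'E Qp Qp'.
  move=> /(allP nb0E)/andP[al ax] /(allP nb0E)/andP[bl bx] /(allP nb0E)/andP[cl' cx].
  move=> ab ca cb; apply: cl; rewrite -?i0 adj_rfs /adj !inordK //.
move=> /allP/(_ (rfs (rev h) r)); rewrite /Q' inord_val rfs_revK.
have : val (rfs (rev h) r) \in nth [::] adj_table 0.
  rewrite -[_ \in _]/(adjn 0 (rfs (rev h) r)).
  by move: xr; rewrite -{1}i0 -{1}(rfs_revK h r) adj_rfs /adj inordK.
rewrite -{1}(cat_take_drop 2 (nth _ _ _)) mem_cat => /orP[|hd]; last exact.
have -> : take 2 (nth [::] adj_table 0) = [:: 1; 2] by vm_compute.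
rewrite !inE => /orP[] /eqP rE _; rewrite -(rfs_revK h r) -(inord_val (rfs _ r)) rE.
  by rewrite -pE.
by rewrite -p'E.
Qed.

Lemma cliq1 x : cliq [set x].
Proof. by apply/cliqP => u v; rewrite !inE => /eqP-> /eqP->; rewrite eqxx. Qed.

Lemma cliq_U1_notin A u : {in A, forall x, adj u x} -> u \notin A.
Proof. by move=> h; apply/negP => /h; rewrite adjxx. Qed.

Lemma cliq_adj A u v : cliq A -> u \in A -> v \in A -> u != v -> adj u v.
Proof. by move=> /cliqP; apply. Qed.

Definition tetra B : bool := cliq B && (#|B| == 4).

Lemma tetraU1 A u : cliq A -> #|A| = 3 -> {in A, forall x, adj u x} -> tetra (u |: A).
Proof.
by move=> cA A3 uA; rewrite /tetra cliq_setU1 // cardsU1 cliq_U1_notin // A3.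
Qed.

(* Three of the five tetrahedra around an edge give the other two; starting
   from the tetrahedra above S that contain d and those across one of their
   faces from d, this reaches every tetrahedron above S. *)
Section Filling.
Variables (gen : {set V600} -> Prop) (S : {set V600}) (d : V600).
Hypothesis gen_near : forall B, tetra B -> S \subset B -> d \in B -> gen B.
Hypothesis gen_across : forall K B, cliq K -> #|K| = 3 -> S \subset K ->
  {in K, forall x, adj d x} -> tetra B -> K \subset B -> gen B.
Hypothesis gen_edge : forall A B1 B2 B3 B, cliq A -> #|A| = 2 ->
  tetra B1 -> tetra B2 -> tetra B3 -> tetra B -> B1 != B2 -> B1 != B3 -> B2 != B3 ->
  A \subset B1 -> A \subset B2 -> A \subset B3 -> A \subset B ->
  gen B1 -> gen B2 -> gen B3 -> gen B.

Let full_edge x p := forall B, tetra B -> x \in B -> p \in B -> gen B.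

(** Of the five tetrahedra around {x, p}, two contain d, and a third is the neighbour of one of
    these across the face opposite to d; these three suffice for [gen_edge]. *)
Lemma fill_edge x p : adj x p -> adj d x -> adj d p -> S \subset [set x; p] ->
  full_edge x p.
Proof.
move=> xp dx dp SA B tB xB pB; set A := [set x; p] in SA.
have cA : cliq A by apply: cliq_setU1 (cliq1 p) _ => y; rewrite inE => /eqP->.
have A2 : #|A| = 2 by rewrite cards2 adj_neq.
have dA : {in A, forall y, adj d y} by move=> y; rewrite !inE => /orP[]/eqP->.
have dNA := cliq_U1_notin dA.
have cdA : cliq (d |: A) by apply: cliq_setU1.
have dA3 : #|d |: A| = 3 by rewrite cardsU1 dNA A2.
have [y [y' [yy' yA y'A]]] := cliq_ext cdA ltac:(by rewrite dA3).
have yA' : {in A, forall x, adj y x} by move=> u uA; apply: yA; rewrite inE uA orbT.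
have yd : adj y d by apply: yA; rewrite setU11.
have cyA : cliq (y |: A) by apply: cliq_setU1.
have yA3 : #|y |: A| = 3 by rewrite cardsU1 cliq_U1_notin // A2.
have dyA : {in y |: A, forall x, adj d x}.
  by move=> u; rewrite in_setU1 => /orP[/eqP->|/dA//]; rewrite adjC.
have [z zd zA] : exists2 z, z != d & {in y |: A, forall x, adj z x}.
  have [u [v [uv uA vA]]] := cliq_ext cyA ltac:(by rewrite yA3).
  by case: (eqVneq u d) uv => [-> dv|ud _]; [exists v; rewrite 1?eq_sym|exists u].
have dNy : d \notin y |: A by apply: cliq_U1_notin.
have AS (C : {set V600}) u : A \subset u |: C -> S \subset u |: C by apply: subset_trans.
have sA u v : A \subset u |: (v |: A) by rewrite setUA subsetUr.
apply: (@gen_edge A (y |: (d |: A)) (y' |: (d |: A)) (z |: (y |: A)) B) => //.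
- exact: tetraU1.
- exact: tetraU1.
- exact: tetraU1.
- apply: contraNneq (cliq_U1_notin yA) => e.
  have : y \in y' |: (d |: A) by rewrite -e setU11.
  by rewrite in_setU1 (negbTE yy').
- apply: contraNneq dNy => e; have : d \in z |: (y |: A) by rewrite -e !inE eqxx orbT.
  by rewrite in_setU1 eq_sym (negbTE zd).
- apply: contraNneq dNy => e; have : d \in z |: (y |: A) by rewrite -e !inE eqxx orbT.
  by rewrite in_setU1 eq_sym (negbTE zd).
- by apply/subsetP => u; rewrite !inE => /orP[]/eqP->.
- by apply: gen_near; rewrite ?tetraU1 ?AS // !inE eqxx orbT.
- by apply: gen_near; rewrite ?tetraU1 ?AS // !inE eqxx orbT.
- apply: (gen_across (K := y |: A)) => //; last exact: subsetUr.
  + by apply: subset_trans SA _; apply: subsetUr.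
  + exact: tetraU1.
Qed.

Lemma fill_link x p p' : adj x p -> adj x p' -> adj p p' ->
  full_edge x p -> full_edge x p' -> forall r, adj x r -> full_edge x r.
Proof.
move=> xp xp' pp' fp fp' r xr.
(* Around {x, r'}, the tetrahedron {x, r', q, q'} and its neighbours across the faces {x, r', q} and
   {x, r', q'} each contain one of the full edges {x, q}, {x, q'}. *)
have cl q q' r' : adj x q -> adj x q' -> adj x r' -> adj q q' -> adj r' q -> adj r' q' ->
    full_edge x q -> full_edge x q' -> full_edge x r'.
  move=> {r xr} xq xq' xr qq' rq rq' fq fq' B tB xB rB.
  have c2 u v : adj u v -> cliq [set u; v].
    by move=> uv; apply: cliq_setU1 (cliq1 v) _ => y; rewrite inE => /eqP->.
  have tri w : adj w x -> adj w r' -> cliq (w |: [set x; r']) /\ #|w |: [set x; r']| = 3.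
    move=> wx wr; have wA : {in [set x; r'], forall y, adj w y}.
      by move=> y; rewrite !inE => /orP[]/eqP->.
    by rewrite cliq_setU1 ?c2 // cardsU1 cliq_U1_notin // cards2 adj_neq.
  have [cq q3] := tri q ltac:(by rewrite adjC) ltac:(by rewrite adjC).
  have [cq' q'3] := tri q' ltac:(by rewrite adjC) ltac:(by rewrite adjC).
  have other w w' : adj w x -> adj w r' -> exists2 a, a != w' &
      {in w |: [set x; r'], forall y, adj a y}.
    move=> wx wr; have [cw w3] := tri w wx wr.
    have [u [v [uv uA vA]]] := cliq_ext cw ltac:(by rewrite w3).
    by case: (eqVneq u w') uv => [-> wv|uw _]; [exists v; rewrite 1?eq_sym|exists u].
  have [a aq' aA] := other q q' ltac:(by rewrite adjC) ltac:(by rewrite adjC).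
  have [b bq bA] := other q' q ltac:(by rewrite adjC) ltac:(by rewrite adjC).
  have q'A : {in q |: [set x; r'], forall y, adj q' y}.
    by move=> y; rewrite !inE => /or3P[]/eqP->; rewrite adjC.
  have q'Nx : q' \notin [set x; r'].
    by rewrite !inE negb_or !adj_neq // adjC.
  have qNx : q \notin [set x; r'].
    by rewrite !inE negb_or !adj_neq // adjC.
  have qq'N : q != q' by apply: adj_neq.
  apply: (@gen_edge [set x; r'] (q' |: (q |: [set x; r'])) (a |: (q |: [set x; r']))
      (b |: (q' |: [set x; r'])) B) => //; rewrite ?tetraU1 ?c2 ?cards2 ?adj_neq //.
  - apply: contraTneq (setU11 q' (q |: [set x; r'])) => ->.
    by rewrite 2!in_setU1 negb_or eq_sym aq' negb_or eq_sym qq'N.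
  - have : q \in q' |: (q |: [set x; r']) by rewrite 2!in_setU1 eqxx orbT.
    apply: contraTneq => ->.
    by rewrite 2!in_setU1 negb_or eq_sym bq negb_or qq'N.
  - have : q \in a |: (q |: [set x; r']) by rewrite 2!in_setU1 eqxx orbT.
    apply: contraTneq => ->.
    by rewrite 2!in_setU1 negb_or eq_sym bq negb_or qq'N.
  - by rewrite setUA subsetUr.
  - by rewrite setUA subsetUr.
  - by rewrite setUA subsetUr.
  - by apply/subsetP => u; rewrite !inE => /orP[]/eqP->.
  - by apply: fq; rewrite ?tetraU1 // !inE eqxx ?orbT.
  - by apply: fq; rewrite ?tetraU1 // !inE eqxx ?orbT.
  - by apply: fq'; rewrite ?tetraU1 // !inE eqxx ?orbT.
pose Q y := `[< full_edge x y >].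
have : Q r.
  apply: (spread_link (Q := Q)) xp xp' pp' _ _ _ r xr; try by apply/asboolP.
  move=> q q' r' xq xq' xr' qq' rq rq' /asboolP fq /asboolP fq'; apply/asboolP.
  exact: (cl q q').
by move/asboolP.
Qed.

Let full x := forall B, tetra B -> x \in B -> gen B.

Lemma fill_vertex x p p' : adj x p -> adj x p' -> adj p p' ->
  full_edge x p -> full_edge x p' -> full x.
Proof.
move=> xp xp' pp' fp fp' B tB xB; have /andP[cB /eqP B4] := tB.
have [p0 pB px] : exists2 p0, p0 \in B & p0 != x.
  have /card_gt0P[p0] : (0 < #|B :\ x|)%N by have := cardsD1 x B; rewrite xB B4; case: #|_|.
  by rewrite !inE => /andP[]; exists p0.
have xp0 : adj x p0 by rewrite adjC; apply: (cliq_adj cB).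
exact: (fill_link xp xp' pp' fp fp' xp0 tB xB pB).
Qed.

Lemma fill_all : cliq S -> {in S, forall x, adj d x} ->
  forall B, tetra B -> S \subset B -> gen B.
Proof.
move=> cS dS B tB SB; have /andP[cB /eqP B4] := tB.
have dNS := cliq_U1_notin dS; have cdS : cliq (d |: S) by apply: cliq_setU1.
have := cliq_card cdS; rewrite cardsU1 dNS add1n ltnS.
have ext1 A : cliq A -> (#|A| < 4)%N -> exists y, {in A, forall x, adj y x}.
  by move=> cA A4; have [y [v [_ yA _]]] := cliq_ext cA A4; exists y.
case S3 : #|S| => [|[|[|[|n]]]] // _.
(* With S empty, d is full by assumption, then each neighbour of d is, and triangles carry this over
   the whole 600-cell. *)
- have SE : S = set0 by apply: cards0_eq.
  have fd : full d by move=> C tC dC; apply: gen_near; rewrite ?SE ?sub0set.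
  have fn p : adj d p -> full p.
    move=> dp; have [||y yA] := ext1 (p |: [set d]).
    + by apply: cliq_setU1 (cliq1 d) _ => y; rewrite inE adjC => /eqP->.
    + by rewrite cards2; case: eqP.
    have yd : adj y d by apply: yA; rewrite !inE eqxx orbT.
    have yp : adj y p by apply: yA; rewrite !inE eqxx.
    apply: (@fill_vertex p d y); rewrite 1?adjC //; first by move=> C tC pC dC; apply: fd.
    apply: fill_edge; rewrite 1?adjC ?SE ?sub0set //.
    by rewrite adjC.
  have [y yd] := ext1 [set d] (cliq1 d) ltac:(by rewrite cards1).
  have dy : adj d y by rewrite adjC yd ?inE.
  pose Q x := `[< full x >].
  have Qall x : Q x.
    apply: (spread_all dy (Q := Q)); try by apply/asboolP; auto.
    move=> q q' r qq' rq rq' /asboolP fq /asboolP fq'; apply/asboolP.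
    by apply: (fill_vertex rq rq' qq') => C tC rC qC; [apply: fq|apply: fq'].
  have /card_gt0P[x xB] : (0 < #|B|)%N by rewrite B4.
  by have /asboolP := Qall x; apply.
(* With S a single vertex x, only the link of x is to be filled, starting from d and a common
   neighbour y of d and x. *)
- have /cards1P[x SE] : #|S| == 1%N by rewrite S3.
  have xB : x \in B by apply: (subsetP SB); rewrite SE set11.
  have dx : adj d x by apply: dS; rewrite SE set11.
  have [|y yA] := ext1 (d |: S) cdS; first by rewrite cardsU1 dNS S3.
  have yd : adj y d by apply: yA; rewrite setU11.
  have yx : adj y x by apply: yA; rewrite SE !inE eqxx orbT.
  suff : full x by apply.
  apply: (@fill_vertex x d y); rewrite 1?adjC //.
    by move=> C tC xC dC; apply: gen_near; rewrite // SE sub1set.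
  apply: fill_edge; rewrite 1?adjC // ?SE ?subsetUl //.
  by rewrite adjC.
- have /cards2P[x [p [xp SE]]] : #|S| == 2 by rewrite S3.
  have xS : x \in S by rewrite SE !inE eqxx.
  have pS : p \in S by rewrite SE !inE eqxx orbT.
  have xp' : adj x p by apply: (cliq_adj cS).
  have Sxp : S \subset [set x; p] by rewrite SE.
  have := fill_edge xp' (dS _ xS) (dS _ pS) Sxp tB.
  by apply; apply: (subsetP SB).
- exact: (gen_across cS S3 (subxx S) dS tB SB).
Qed.

End Filling.

End Graph600.

(** * Right-angled reflection groups *)

Section RightAngled.
Local Open Scope ring_scope.
Variables (R : realFieldType) (U : lmodType R) (T : finType) (adj : rel T).
Variables (rt : T -> U) (pr : T -> U -> R) (x0 : U).

(* [pr t] is the pairing with the root [rt t]; the mirrors of two roots are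
   orthogonal if they are adjacent, and ultraparallel or asymptotic if not. *)
Record right_angled : Prop := RightAngled {
  ra_adjC : symmetric adj;
  ra_adjxx : irreflexive adj;
  ra_prB : forall t a x y, pr t (x - a *: y) = pr t x - a * pr t y;
  ra_pr_rt : forall t, pr t (rt t) = 1;
  ra_pr_adj : forall t u, adj t u -> pr t (rt u) = 0;
  ra_pr_far : forall t u, t != u -> ~~ adj t u -> pr t (rt u) <= -1;
  ra_pr_x0 : forall t, pr t x0 = 1;
  ra_two_far : forall t,
    exists u v, [/\ u != v, t != u, t != v, ~~ adj t u & ~~ adj t v] }.

Hypothesis ra : right_angled.
Let adjC := ra_adjC ra.
Let adjxx := ra_adjxx ra.
Let prB := ra_prB ra.
Let pr_rt := ra_pr_rt ra.
Let pr_adj := ra_pr_adj ra.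
Let pr_far := ra_pr_far ra.
Let pr_x0 := ra_pr_x0 ra.
Let two_far := ra_two_far ra.

Implicit Types (t u v : T) (w z : seq T) (A B : {set T}) (x y : U).

Definition refl t x : U := x - (2 * pr t x) *: rt t.

(* The head of a word is its last letter. *)
Definition act w x : U := foldl (fun y t => refl t y) x w.

Definition nb t : {set T} := [set u | adj t u].

(* When the letters of [w] are fired one after the other, starting from the set
   [A] of right descents, [descent A w] is the set of right descents of the
   result, as long as every letter lengthens the element ([ascending]). *)
Definition descent A w : {set T} := foldr (fun t B => t |: B :&: nb t) A w.

Fixpoint ascending A w : bool :=
  if w is t :: w' then (t \notin descent A w') && ascending A w' else true.

Notation D := (descent set0).
Notation asc := (ascending set0).
Notation eqw w w' := (act w =1 act w').

Definition far t u := (t != u) && ~~ adj t u.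

Lemma far_pr t u : far t u -> pr t (rt u) <= -1.
Proof. by move=> /andP[]; apply: pr_far. Qed.

Variant rel_spec t u : bool -> bool -> bool -> Prop :=
| Rel_eq of t = u & pr t (rt u) = 1 : rel_spec t u true false false
| Rel_adj of pr t (rt u) = 0 : rel_spec t u false true false
| Rel_far of pr t (rt u) <= -1 : rel_spec t u false false true.

Lemma relP t u : rel_spec t u (t == u) (adj t u) (far t u).
Proof.
rewrite /far; case: eqVneq => [<-|tu] /=; first by rewrite adjxx; constructor.
by case: (boolP (adj t u)) => [/pr_adj|/(pr_far tu)] ?; constructor.
Qed.

Lemma farC t u : far t u = far u t.
Proof. by rewrite /far eq_sym adjC. Qed.

Lemma pr_le0 t u : t != u -> pr t (rt u) <= 0.
Proof. by case: relP => [_ _ //|h _|h _]; lra. Qed.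

Lemma pr_refl t u x : pr u (refl t x) = pr u x - 2 * pr t x * pr u (rt t).
Proof. by rewrite /refl prB. Qed.

Lemma reflB t a x y : refl t (x - a *: y) = refl t x - a *: refl t y.
Proof.
rewrite /refl prB mulrBr scalerBl (mulrCA 2 a) scalerBr scalerA !opprB.
by rewrite addrACA [RHS]addrACA; congr (_ + _); rewrite addrC.
Qed.

Lemma reflK t : involutive (refl t).
Proof.
move=> x; rewrite {1}/refl pr_refl pr_rt /refl.
rewrite (_ : 2 * (_ - _) = - (2 * pr t x)); last by ring.
by rewrite scaleNr opprK subrK.
Qed.

Lemma refl_comm t u x : adj t u -> refl t (refl u x) = refl u (refl t x).
Proof.
move=> tu; rewrite {1}[refl u x]/refl reflB [refl u (refl t x)]/refl pr_refl.
rewrite (pr_adj (t := u)) 1?adjC // mulr0 subr0.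
by rewrite /refl (pr_adj tu) mulr0 scale0r subr0.
Qed.

Lemma act_cat w z x : act (w ++ z) x = act z (act w x).
Proof. by rewrite /act foldl_cat. Qed.

Lemma actB w a x y : act w (x - a *: y) = act w x - a *: act w y.
Proof. by elim: w x y => //= t w ih x y; rewrite reflB ih. Qed.

Lemma act_cons t w x : act (t :: w) x = act w x - (2 * pr t x) *: act w (rt t).
Proof. by rewrite -actB. Qed.

Lemma act_rev w : cancel (act w) (act (rev w)).
Proof.
elim/last_ind: w => // w t ih x.
by rewrite rev_rcons -cats1 act_cat /= reflK ih.
Qed.

Lemma act_revK w : cancel (act (rev w)) (act w).
Proof. by move=> x; rewrite -{1}[w]revK act_rev. Qed.

Lemma act_inj w : injective (act w). Proof. exact: can_inj (act_rev w). Qed.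

Lemma eqw_cons t w w' : eqw w w' -> eqw (t :: w) (t :: w').
Proof. by move=> e x; rewrite /= -/(act _ _) e. Qed.

Lemma eqw_cons2 t w : eqw (t :: t :: w) w.
Proof. by move=> x /=; rewrite reflK. Qed.

Lemma descent_cat A w z : descent A (w ++ z) = descent (descent A z) w.
Proof. by rewrite /descent foldr_cat. Qed.

Lemma ascending_cat A w z :
  ascending A (w ++ z) = ascending (descent A z) w && ascending A z.
Proof. by elim: w => //= t w ->; rewrite andbA descent_cat. Qed.

Lemma descent_mono A B w : A \subset B -> descent A w \subset descent B w.
Proof.
by move=> AB; elim: w => //= t w ih; apply: setUS; apply: setSI.
Qed.

Lemma ascending_mono A B w : A \subset B -> ascending B w -> ascending A w.
Proof.
move=> AB; elim: w => //= t w ih /andP[tD /ih ->]; rewrite andbT.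
by apply: contra tD; apply/subsetP/descent_mono.
Qed.

Lemma descent_letters w : {subset D w <= w}.
Proof.
elim: w => [u|t w ih u] /=; first by rewrite inE.
by rewrite !inE => /orP[->//|/andP[/ih -> _]]; rewrite orbT.
Qed.

Lemma in_descent_cons A t w u :
  (u \in descent A (t :: w)) = (u == t) || (u \in descent A w) && adj t u.
Proof. by rewrite /= !inE. Qed.

Lemma descent_adj w : {in D w &, forall u v, u != v -> adj u v}.
Proof.
elim: w => [u v|t w ih u v]; first by rewrite inE.
rewrite !in_descent_cons => /orP[/eqP->|/andP[uD tu]] /orP[/eqP->|/andP[vD tv]].
- by rewrite eqxx.
- by [].
- by rewrite adjC.
- exact: ih.
Qed.

(* Firing invariant: the nonnegativity of the second sum is what keeps a
   descent u nonnegative when a letter far from u is fired. *)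
Definition fair A (f : T -> R) : Prop :=
  (forall u, u \notin A -> 0 <= f u) /\
  (forall u v, u \in A -> far u v -> 0 <= f u + f v).

(** Firing t leaves its neighbours alone and adds at least 2 * f t to every letter far from t. A
    descent u far from t stops being a descent, and f u >= - f t ensures that its new value is
    nonnegative. *)
Lemma fair_step A t f : fair A f -> t \notin A ->
  fair (t |: A :&: nb t) (fun u => f u - 2 * pr t (rt u) * f t).
Proof.
move=> [f0 fA] tA; have ft := f0 _ tA.
have mono u : u != t -> f u <= f u - 2 * pr t (rt u) * f t.
  move=> ut; rewrite lerBrDr gerDl -mulrA pmulr_rle0 //.
  by rewrite mulr_le0_ge0 // pr_le0 // eq_sym.
have big u : far t u -> 2 * f t <= - (2 * pr t (rt u) * f t).
  move=> /far_pr h; rewrite -mulNr ler_wpM2r //; lra.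
split=> [u|u v].
  rewrite !inE negb_or negb_and => /andP[ut]; case: (boolP (u \in A)) => /= uA tu.
    have fu : far t u by rewrite /far eq_sym ut.
    have := fA u t uA; rewrite farC => /(_ fu); have := big _ fu; lra.
  by move: (mono _ ut) (f0 _ uA); lra.
rewrite !inE => /orP[/eqP->|/andP[uA tu]] uv.
  rewrite pr_rt; have vt : v != t by move: uv; rewrite farC => /andP[].
  have := big _ uv; case: (boolP (v \in A)) => vA; last by move: (f0 _ vA); lra.
  by have := fA v t vA; rewrite farC => /(_ uv); lra.
rewrite pr_adj // mulr0 mul0r subr0; have vt : v != t.
  by apply: contraTneq uv => ->; rewrite /far adjC tu andbF.
by move: (mono _ vt) (fA _ _ uA uv); lra.
Qed.

(** * Linear functionals along words, descents and reduced words *)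

Definition linform (psi : U -> R) := forall a x y, psi (x - a *: y) = psi x - a * psi y.

Lemma fair_word psi A w : linform psi -> ascending A w ->
  fair A (fun u => psi (rt u)) ->
  fair (descent A w) (fun u => psi (act w (rt u))).
Proof.
move=> lin; elim: w => //= t w ih /andP[tD /ih h] /h /fair_step /(_ tD).
have e u : psi (act w (refl t (rt u)))
    = psi (act w (rt u)) - 2 * pr t (rt u) * psi (act w (rt t)).
  by rewrite /refl actB lin.
by case=> [h1 h2]; split=> [u|u v]; rewrite !e; [apply: h1|apply: h2].
Qed.

(* Minus the sum of the roots stands for [x0]: all that matters is that its
   pairing with every root is positive. *)
Definition height x : R := - \sum_v pr v x.

Lemma height_lin : linform height.
Proof.
move=> a x y; rewrite /height (eq_bigr _ (fun v _ => prB v a x y)).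
by rewrite sumrB -mulr_sumr opprB mulrN opprK addrC.
Qed.

(** The root itself contributes -1, two far roots at least 1 each, and no other term is negative. *)
Lemma height_rt t : 1 <= height (rt t).
Proof.
have [u [v [uv tu tv ntu ntv]]] := two_far t.
rewrite /height (bigD1 t) //= (bigD1 u) 1?eq_sym //= (bigD1 v) /=; last first.
  by rewrite eq_sym tv eq_sym uv.
have : \sum_(i | (i != t) && (i != u) && (i != v)) pr i (rt t) <= 0.
  by apply: sumr_le0 => i /andP[/andP[it _] _]; apply: pr_le0.
have : pr u (rt t) <= -1 by apply: pr_far; rewrite 1?eq_sym // adjC.
have : pr v (rt t) <= -1 by apply: pr_far; rewrite 1?eq_sym // adjC.
by rewrite pr_rt; lra.
Qed.

(** The Coxeter criterion: a letter is a right descent exactly when the element makes its root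
    negative, with [height] as the sign. Hence the descent set depends on the group element
    alone. *)
Lemma asc_sign w u : asc w ->
  if u \in D w then height (act w (rt u)) <= -1 else 1 <= height (act w (rt u)).
Proof.
elim: w u => [|t w ih] u /=; first by rewrite inE height_rt.
move=> /andP[tD aw]; have {}ih := ih^~ aw.
rewrite /refl actB height_lin; have := ih t; rewrite (negbTE tD) => ht.
rewrite !inE; case: (eqVneq u t) => [->|ut] /=; first by rewrite pr_rt; lra.
case: (boolP (adj t u)) => [tu|tu]; first by rewrite andbT pr_adj //; have := ih u; case: ifP; lra.
have fu : far t u by rewrite /far eq_sym ut.
have := far_pr fu; rewrite andbF => le1.
have : 2 * height (act w (rt t)) <= - (2 * pr t (rt u) * height (act w (rt t))).
  by rewrite -mulNr ler_wpM2r; lra.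
have [_ fair2] : fair (D w) (fun u => height (act w (rt u))).
  apply: fair_word => //; first exact: height_lin.
  by split=> [v _|v ?]; rewrite ?inE //; have := height_rt v; lra.
have := ih u; case: ifP => [uD _|_]; last by lra.
by have := fair2 u t uD; rewrite farC => /(_ fu); lra.
Qed.

Lemma descentE w u : asc w -> (u \in D w) = (height (act w (rt u)) < 0).
Proof. by move=> /(asc_sign u); case: ifP => _ h; apply/esym; apply/idP/idP; lra. Qed.

Lemma descent_eqw w w' : asc w -> asc w' -> eqw w w' -> D w = D w'.
Proof. by move=> aw aw' e; apply/setP => u; rewrite !descentE // e. Qed.

(** A descent is adjacent to all the letters that follow it, so it commutes past them to the end of
    the word. *)
Lemma asc_exchange w u : asc w -> u \in D w ->
  exists w', [/\ asc (u :: w'), size w = (size w').+1 & eqw w (u :: w')].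
Proof.
elim: w => [|t w ih]; first by rewrite inE.
rewrite in_descent_cons => atw.
have /= /andP[tD aw] := atw.
have [->|ut] /= := eqVneq u t; first by exists w.
move=> /andP[/(ih aw)[w' [aw' sw e]] tu]; exists (t :: w').
have tD' : t \notin D (u :: w') by rewrite -(descent_eqw aw aw' e).
move: aw' tD' => /= /andP[uw' aw']; rewrite !inE negb_or negb_and adjC tu orbF.
move=> /andP[_ tw']; split; last 1 first.
- move=> x.
  by rewrite /= -/(act _ _) e /= refl_comm // adjC.
- by rewrite (negbTE ut) (negbTE uw') tw' aw'.
- by rewrite /= sw.
Qed.

Lemma asc_reduce w : exists w', [/\ asc w', eqw w w' & (size w' <= size w)%N].
Proof.
elim: w => [|t w [w' [aw' e sz]]]; first by exists [::].
case: (boolP (t \in D w')) => tD; last first.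
  by exists (t :: w'); rewrite /= tD aw'; split=> //; apply: eqw_cons.
have [z [/= /andP[_ az] szw e']] := asc_exchange aw' tD; exists z; split=> //.
  by move=> x; rewrite (eqw_cons t e) (eqw_cons t e') eqw_cons2.
by rewrite -ltnS -szw; apply: leq_trans sz _; apply: leqW.
Qed.

Lemma asc_size w w' : asc w -> asc w' -> eqw w w' -> size w = size w'.
Proof.
elim: w w' => [|t w ih] w' aw aw' e.
  case: w' aw' e => // t w' /= a e.
  have := descent_eqw (w := [::]) isT (w' := t :: w') a e.
  by move=> /setP/(_ t); rewrite !inE eqxx.
have tD : t \in D w' by rewrite -(descent_eqw aw aw' e) /= setU11.
have [z [/= /andP[_ az] -> e']] := asc_exchange aw' tD; congr _.+1.
move: aw => /= /andP[_ aw]; apply: ih => // x.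
by rewrite -(eqw_cons2 t w) (eqw_cons t e) (eqw_cons t e') eqw_cons2.
Qed.

(** * Stabilizers of vertices and of cells *)

Lemma act_cons_x0 t w : act (t :: w) x0 = act w x0 - 2 *: act w (rt t).
Proof. by rewrite act_cons pr_x0 mulr1. Qed.

Lemma height_asc t w : asc (t :: w) -> height (act (t :: w) x0) < height (act w x0).
Proof.
case/andP=> tD aw; have := asc_sign t aw; rewrite (negbTE tD).
by rewrite act_cons_x0 height_lin; lra.
Qed.

(** Each letter of an ascending word strictly lowers the height of the image of [x0], so only the
    empty ascending word fixes [x0]. *)
Lemma act_x0_inj w w' : act w x0 = act w' x0 -> eqw w w'.
Proof.
move=> e; have [z [az ez _]] := asc_reduce (w' ++ rev w).
have z0 : act z x0 = x0 by rewrite -ez act_cat -e act_rev.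
suff zN : z = [::].
  by move=> x; rewrite -(act_revK w (act w' x)) -(act_cat w') ez zN.
have le w1 : asc w1 -> height (act w1 x0) <= height x0.
  elim: w1 => // t w1 ih aty; apply: le_trans (ltW (height_asc aty)) _.
  by apply: ih; case/andP: aty.
case: z az z0 {ez} => // t z atz z0; have := height_asc atz; rewrite z0.
have /le : asc z by case/andP: atz.
by rewrite leNgt => /negP.
Qed.

(** The roots of a clique are orthonormal and [x0] pairs to 1 with each, so this is the projection
    of [x0] to the intersection of their mirrors: the centre of a cell, up to scaling. *)
Definition clique_point A : U := x0 - \sum_(v in A) rt v.

Definition is_clique A : Prop := {in A &, forall u v, u != v -> adj u v}.

Lemma pr0 t : pr t 0 = 0.
Proof. by have := prB t 1 0 0; rewrite scaler0 subrr mul1r subrr. Qed.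

Lemma prD t x y : pr t (x + y) = pr t x + pr t y.
Proof. by have := prB t (-1) x y; rewrite scaleN1r opprK mulN1r opprK. Qed.

Lemma pr_sum t A : pr t (\sum_(v in A) rt v) = \sum_(v in A) pr t (rt v).
Proof. by apply: (big_morph (pr t)) => [x y|]; rewrite ?prD ?pr0. Qed.

Lemma pr_cell t A : is_clique A ->
  if t \in A then pr t (clique_point A) = 0 else 1 <= pr t (clique_point A).
Proof.
move=> cA; have := prB t 1 x0 (\sum_(v in A) rt v).
rewrite scale1r mul1r pr_x0 pr_sum => ->; case: ifP => tA.
  rewrite (bigD1 t) //= pr_rt big1 ?addr0 ?subrr // => u /andP[uA ut].
  by apply: pr_adj; apply: cA; rewrite // eq_sym.
rewrite lerBrDr gerDl; apply: sumr_le0 => u uA; apply: pr_le0.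
by apply: contraFneq tA => ->.
Qed.

Lemma pr_cell_ge0 t A : is_clique A -> 0 <= pr t (clique_point A).
Proof. by move=> /(pr_cell t); case: ifP => _ h; lra. Qed.

Lemma act_cell A z : is_clique A -> {subset z <= A} -> act z (clique_point A) = clique_point A.
Proof.
move=> cA; elim: z => //= t z ih zA; have := pr_cell t cA.
rewrite zA ?mem_head // => e; rewrite /refl e mulr0 scale0r subr0.
by apply: ih => u uz; apply: zA; rewrite inE uz orbT.
Qed.

Lemma actZ w a x : act w (a *: x) = a *: act w x.
Proof.
have act0 : act w 0 = 0.
  by elim: w => //= t w; rewrite /refl pr0 mulr0 scale0r subr0.
by rewrite -[a *: x]opprK -scaleNr -[- _]sub0r actB act0 sub0r scaleNr opprK.
Qed.

(** Fairness, started from the descent set {t}, makes [pr t (act z (rt u))] nonpositive for each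
    letter u about to be fired; so every letter can only increase the pairing of the image of a
    dominant x with the root of t. *)
Lemma root_pos z t x : asc (rcons z t) -> (forall v, 0 <= pr v x) ->
  pr t x <= pr t (act z x).
Proof.
rewrite -cats1 ascending_cat => /andP[az _] x_ge0.
have {az} : ascending [set t] z by move: az; rewrite /= set0I setU0.
elim: z => // u z ih auz; case/andP: (auz) => uD az.
rewrite act_cons prB; apply: le_trans (ih az) _.
have [h _] : fair (descent [set t] z) (fun u => - pr t (act z (rt u))).
  apply: (fair_word (psi := fun x => - pr t x)) => //.
    by move=> a y y'; rewrite prB opprB mulrN opprK addrC.
  split=> [v|v v']; rewrite inE.
    by rewrite eq_sym => /pr_le0; lra.
  by move=> /eqP-> /far_pr; rewrite pr_rt; lra.
have := mulr_ge0 (x_ge0 u) (h _ uD); lra.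
Qed.

Lemma act_cell_eq A A' z : is_clique A -> is_clique A' ->
  asc z -> act z (clique_point A') = clique_point A -> A = A' /\ {subset z <= A}.
Proof.
move=> cA cA'; elim/last_ind: z => [|z t ih] az e.
  split=> //; apply/setP => t; have := pr_cell t cA; have := pr_cell t cA'.
  by rewrite -e /=; do 2![case: ifP => _]; lra.
have := root_pos az (fun v => pr_cell_ge0 v cA'); have := pr_cell_ge0 t cA'.
move: e; rewrite -cats1 act_cat /= => e; have : pr t (clique_point A) = - pr t (act z (clique_point A')).
  by rewrite -e pr_refl pr_rt; lra.
have := pr_cell t cA; case: ifP => [tA h0 h1 _ _|_]; last by clear ih e; move=> *; exfalso; lra.
have [] : A = A' /\ {subset z <= A}.
  apply: ih; last by rewrite -[LHS](reflK t) e /refl h0 mulr0 scale0r subr0.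
  by move: az; rewrite -cats1 ascending_cat /= => /andP[+ _];
    apply: ascending_mono; apply: sub0set.
move=> AA zA; split=> // u; rewrite mem_cat inE => /orP[/zA //|/eqP ->].
by have := pr_cell t cA; rewrite h0; case: ifP => // _; lra.
Qed.

Lemma cell_inj A A' w w' : is_clique A -> is_clique A' ->
  act w (clique_point A) = act w' (clique_point A') ->
  A = A' /\ exists2 z, {subset z <= A} & eqw w' (z ++ w).
Proof.
move=> cA cA' e; have [z [az ez _]] := asc_reduce (w' ++ rev w).
have [|AA zA] := act_cell_eq cA cA' az.
  by rewrite -ez act_cat -e act_rev.
by split=> //; exists z => // x; rewrite act_cat -ez act_cat act_revK.
Qed.

(** * Position of a vertex relative to a mirror *)

Definition root_pairing t w : R := pr t (act w x0).

Lemma wall_cons t u w : root_pairing t (u :: w) = root_pairing t w - 2 * pr t (act w (rt u)).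
Proof. by rewrite /root_pairing act_cons_x0 prB. Qed.

(** The vertices fall into a near layer, where all letters commute with t, and two sides. Fairness
    with either sign records that an ascending word which has left the layer does not return. *)
Variant wall_spec t w : Prop :=
| Wall_on of root_pairing t w = 1 & all (adj t) w
    & (forall x, pr t (act w x) = pr t x)
| Wall_beyond of root_pairing t w <= -1 & fair (D w) (fun u => pr t (act w (rt u)))
| Wall_before of 3 <= root_pairing t w & fair (D w) (fun u => - pr t (act w (rt u))).

(** The first letter not adjacent to t decides: t itself leads across the mirror, a far letter leads
    away from it. *)
Lemma wallP t w : asc w -> wall_spec t w.
Proof.
elim: w => [_|u w ih auw]; first by apply: Wall_on; rewrite // /root_pairing pr_x0.
have /= /andP[uD aw] := auw; have := wall_cons t u w.
case: (ih aw) => [q1 tw inv|q1 fw|q3 fw]; last 2 first.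
- move=> e; apply: Wall_beyond; first by rewrite e; have := fw.1 _ uD; lra.
  have [h1 h2] := fair_step fw uD.
  by split=> [v /h1|v v' vD /(h2 _ _ vD)]; rewrite !act_cons !prB.
- move=> e; apply: Wall_before; first by rewrite e; have := fw.1 _ uD; lra.
  have [h1 h2] := fair_step fw uD.
  by split=> [v /h1|v v' vD /(h2 _ _ vD)]; rewrite !act_cons !prB; lra.
have Dt v : v \in D w -> adj t v by move=> /descent_letters/(allP tw).
rewrite inv q1; have [tu|tu] := eqVneq t u.
- subst u; rewrite pr_rt => e; apply: Wall_beyond; first by lra.
  have e' v : pr t (act (t :: w) (rt v)) = - pr t (rt v).
    by rewrite act_cons prB !inv pr_rt; lra.
  split=> [v|v v']; rewrite in_descent_cons !e' ?negb_or.
    by move=> /andP[+ _]; rewrite eq_sym => /pr_le0; lra.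
  move=> /orP[/eqP->|/andP[_ tv] vv']; first by move=> /far_pr; rewrite pr_rt; lra.
  have : v' != t by apply: contraTneq vv' => ->; rewrite /far adjC tv andbF.
  by rewrite eq_sym => /pr_le0; rewrite (pr_adj tv); lra.
- move=> e; have := relP t u; rewrite (negbTE tu).
  case: (boolP (adj t u)) => [atu _|_]; last first.
    case: (boolP (far t u)) => [ftu _|_ h]; last by inversion h.
    have := far_pr ftu => h; apply: Wall_before; first by lra.
    (* The value at t is -1, so t has to count as a descent before u is fired; as u is far from t,
       firing it removes t again. *)
    have : fair (t |: D w) (fun v => - pr t (act w (rt v))).
      split=> [v|v v']; rewrite !inE ?negb_or !inv.
        by move=> /andP[+ _]; rewrite eq_sym => /pr_le0; lra.
      move=> /orP[/eqP->|/Dt tv vv']; first by move=> /far_pr; rewrite pr_rt; lra.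
      have : v' != t by apply: contraTneq vv' => ->; rewrite /far adjC tv andbF.
      by rewrite eq_sym => /pr_le0; rewrite (pr_adj tv); lra.
    move=> fu; have := fair_step (t := u) fu; rewrite in_setU1 eq_sym (negbTE tu) (negbTE uD).
    have nut : ~~ adj u t by rewrite adjC; case/andP: ftu.
    have -> : u |: (t |: D w) :&: nb u = D (u :: w).
      apply/setP => v; rewrite !inE; have [->|//] := eqVneq v t.
      by rewrite (negbTE nut) !andbF.
    move=> /(_ isT)[h1 h2].
    by split=> [v /h1|v v' vD /(h2 _ _ vD)]; rewrite !act_cons !prB; lra.
  apply: Wall_on; first by rewrite e pr_adj //; lra.
    by rewrite /= atu tw.
  by move=> x; rewrite act_cons prB !inv (pr_adj atu) mulr0 subr0.
Qed.

Lemma wall_eqw t w w' : eqw w w' -> root_pairing t w = root_pairing t w'.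
Proof. by move=> e; rewrite /root_pairing e. Qed.

Lemma wall_cases t w : [\/ root_pairing t w = 1, root_pairing t w <= -1 | 3 <= root_pairing t w].
Proof.
have [w' [aw' e _]] := asc_reduce w; rewrite (wall_eqw t e).
by case: (wallP t aw') => *; [apply: Or31|apply: Or32|apply: Or33].
Qed.

Lemma wall1_cons t u w : root_pairing t w = 1 -> root_pairing t (u :: w) = 1 - 2 * pr t (rt u).
Proof.
move=> q1; have [w' [aw' e _]] := asc_reduce w.
rewrite wall_cons q1 e; move: q1; rewrite (wall_eqw t e).
by case: (wallP t aw') => [_ _ ->|?|?]; lra.
Qed.

Lemma wall1_adj t w : asc w -> root_pairing t w = 1 -> all (adj t) w.
Proof. by move=> /(wallP t); case=> // ? _; lra. Qed.

Lemma asc_wall t u w : asc (u :: w) -> root_pairing t (u :: w) <= 1 -> root_pairing t w <= 1.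
Proof.
move=> /= /andP[uD /(wallP t)[-> //||q3 fw]]; first by lra.
by rewrite wall_cons; have := fw.1 _ uD; lra.
Qed.

(** If u is not a descent, fairness applies. If it is, the step undoes a last letter u: the vertex
    before it is beyond the mirror too, or on the near layer, and then only u = t can have
    crossed. *)
Lemma wall_beyond_cons t u w : root_pairing t w <= -1 ->
  root_pairing t (u :: w) <= -1 \/ root_pairing t (u :: w) = 1 /\ u = t.
Proof.
have [w' [aw' e _]] := asc_reduce w.
rewrite (wall_eqw t e) (wall_eqw t (eqw_cons u e)).
case: (boolP (u \in D w')) => uD q1; last first.
  left; rewrite wall_cons; case: (wallP t aw') => [q _ _|_ fw|q _]; try lra.
  by have := fw.1 _ uD; lra.
have [z [auz _ ez]] := asc_exchange aw' uD.
rewrite (wall_eqw t (eqw_cons u ez)) (wall_eqw t (eqw_cons2 u z)).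
move: q1; rewrite (wall_eqw t ez).
have /= /andP[uz az] := auz; case: (wallP t az) => [q _ _|q _|q fw]; last 2 first.
- by left.
- by rewrite wall_cons; have := fw.1 _ uz => ? ?; exfalso; lra.
rewrite (wall1_cons _ q) => h; right; split=> //.
by case: (eqVneq t u) => // /pr_le0 ?; exfalso; lra.
Qed.

Lemma asc_beyond t u w : asc (u :: w) -> root_pairing t w <= -1 -> root_pairing t (u :: w) <= -1.
Proof.
case/andP=> uD /(wallP t)[q _ _|_ fw|q _]; try lra.
by rewrite wall_cons; have := fw.1 _ uD; lra.
Qed.

Lemma rt_inj : injective rt.
Proof.
move=> t u e; case: (eqVneq t u) => // /pr_le0; rewrite -e pr_rt.
by clear e; move=> ?; exfalso; lra.
Qed.

Lemma asc_min w : (forall w', eqw w w' -> (size w <= size w')%N) -> asc w.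
Proof.
elim: w => // t w ih min; have aw : asc w.
  by apply: ih => w' /(eqw_cons t)/min.
rewrite /= aw andbT; apply/negP => /(asc_exchange aw)[w' [_ sw e]].
have := min w' _; rewrite /= sw ltnNge leqnSn => h; apply: notF; apply: h => x.
by rewrite (eqw_cons t e) eqw_cons2.
Qed.

Lemma clique_word z A : is_clique A -> {subset z <= A} ->
  exists s, [/\ uniq s, {subset s <= A} & eqw z s].
Proof.
move=> cA; elim: z => [|u z ih] zA; first by exists [::].
have uA : u \in A by apply: zA; rewrite mem_head.
have [|s [us sA e]] := ih; first by move=> v vz; apply: zA; rewrite inE vz orbT.
have pull w : {subset w <= A} -> u \in w -> eqw w (u :: rem u w).
  elim: w => // v w ihw wA; rewrite inE /= eq_sym.
  case: (eqVneq v u) => [-> //|vu] /= uw x /=.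
  rewrite ihw //=; last by move=> v' v'w; apply: wA; rewrite inE v'w orbT.
  by rewrite refl_comm //; apply: cA => //; rewrite ?wA ?mem_head // eq_sym.
case: (boolP (u \in s)) => uNs; last first.
  exists (u :: s); split=> [|v|]; first by rewrite /= uNs.
    by rewrite inE => /orP[/eqP->|/sA].
  exact: eqw_cons.
exists (rem u s); split=> [|v /mem_rem/sA//|x]; first exact: rem_uniq.
by rewrite (eqw_cons u e) (eqw_cons u (pull s sA uNs)) eqw_cons2.
Qed.

Lemma asc_clique_word s w : asc w -> uniq s -> {in s &, forall u v, u != v -> adj u v} ->
  {in s, forall u, u \notin D w} ->
  asc (s ++ w) /\ forall v, v \in D (s ++ w) =
    (v \in s) || (v \in D w) && all (adj v) s.
Proof.
move=> aw; elim: s => [|u s ih]; first by move=> _ _ _; split=> // v; rewrite andbT.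
move=> /= /andP[uNs us] cs sD; have [||-> De] := ih us.
- by move=> x y xs ys; apply: cs; rewrite inE ?xs ?ys orbT.
- by move=> x xs; apply: sD; rewrite inE xs orbT.
have us' v : v \in s -> adj u v.
  move=> vs; apply: cs; rewrite ?inE ?eqxx ?vs ?orbT //.
  by apply: contraNneq uNs => ->.
rewrite De (negbTE uNs) (negbTE (sD u (mem_head u s))); split=> // v.
rewrite !inE De adjC; case: (eqVneq v u) => //= _.
case: (boolP (v \in s)) => [/us'|_] /=; first by rewrite adjC => ->.
by rewrite -andbA [_ && adj v u]andbC.
Qed.

End RightAngled.

(** * The mosaic as a right-angled reflection group *)

Section CosValues.
Local Open Scope ring_scope.
Variable R : realType.

Lemma cos_pi_div_gt0 (n : nat) : (2 < n)%N -> 0 < cos (pi / n%:R : R).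
Proof.
move=> n2; have pi0 := pi_gt0 R; apply: cos_gt0_pihalf; apply/andP; split.
  apply: (@lt_trans _ _ 0); first by rewrite oppr_lt0 divr_gt0.
  by rewrite divr_gt0 // ltr0n (ltn_trans _ n2).
by rewrite ltr_pM2l // ltf_pV2 ?posrE ?ltr0n ?ltr_nat // (ltn_trans _ n2).
Qed.

Lemma cos_double (x : R) : cos (x *+ 2) = 2 * cos x ^+ 2 - 1.
Proof. by rewrite mulr2n cosD -!expr2 sin2cos2; ring. Qed.

Lemma cos_triple (x : R) : cos (x *+ 3) = 4 * cos x ^+ 3 - 3 * cos x.
Proof.
rewrite mulrS cosD cos_double mulr2n sinD.
have -> : sin x * (sin x * cos x + cos x * sin x) = 2 * cos x * sin x ^+ 2 by ring.
by rewrite sin2cos2; ring.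
Qed.

Lemma cos_pi3 : cos (pi / 3 : R) = 1 / 2.
Proof.
have := @cos_pi_div_gt0 3 isT; set c := cos _ => c0.
have : cos ((pi / 3 : R) *+ 3) = - 1 by rewrite -(cospi R); congr cos; field.
rewrite cos_triple -/c => e.
have : (c + 1) * (2 * c - 1) ^+ 2 = 4 * c ^+ 3 - 3 * c + 1 by ring.
rewrite e addNr.
by move/eqP; rewrite mulf_eq0 sqrf_eq0 => /orP[]/eqP; lra.
Qed.

Definition sqrt2 : R := 2 * cos (pi / 4).

Definition golden : R := 2 * cos (pi / 5).

Lemma sqrt2_gt0 : 0 < sqrt2.
Proof. by rewrite /sqrt2; have := @cos_pi_div_gt0 4 isT; lra. Qed.

Lemma sqrt2_sqr : sqrt2 * sqrt2 = 2.
Proof.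
have : cos ((pi / 4 : R) *+ 2) = 0.
  by rewrite -[RHS](cos_pihalf R); congr cos; field.
by rewrite cos_double /sqrt2; nra.
Qed.

Lemma phi_gt0 : 0 < golden.
Proof. by rewrite /golden; have := @cos_pi_div_gt0 5 isT; lra. Qed.

(** From cos (3 pi / 5) = - cos (2 pi / 5) comes a cubic in c = cos (pi / 5) divisible by c + 1; the
    other factor, 4 c^2 - 2 c - 1, is the equation of phi = 2 c. *)
Lemma phi_sqr : golden * golden = golden + 1.
Proof.
rewrite /golden; have := @cos_pi_div_gt0 5 isT; set c := cos _ => c0.
have : cos ((pi / 5 : R) *+ 3) = - cos ((pi / 5 : R) *+ 2).
  by rewrite -[in RHS]cosN -cosDpi; congr cos; field.
rewrite cos_triple cos_double -/c => e.
have : (c + 1) * (4 * c ^+ 2 - 2 * c - 1)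
    = 4 * c ^+ 3 - 3 * c + (2 * c ^+ 2 - 1) by ring.
rewrite e addNr.
move/eqP; rewrite mulf_eq0 => /orP[]/eqP h; first by lra.
by nra.
Qed.

Lemma phi_ge1 : 1 <= golden.
Proof. by have := phi_sqr; have := phi_gt0; nra. Qed.

End CosValues.

(** * The 120 roots as vectors *)

Section Roots.
Local Open Scope ring_scope.
Variable R : realType.
Local Notation s := (sqrt2 R).
Local Notation phi := (golden R).
Local Notation gram := (gram R).
Local Notation reflection := (@reflection R).

Definition gram_tbl : seq (seq R) :=
  [:: [:: 1; - (s / 2); 0; 0; 0];
      [:: - (s / 2); 1; - (1 / 2); 0; 0];
      [:: 0; - (1 / 2); 1; - (1 / 2); 0];
      [:: 0; 0; - (1 / 2); 1; - (phi / 2)];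
      [:: 0; 0; 0; - (phi / 2); 1]].

Lemma gramE (i j : 'I_5) : gram i j = nth 0 (nth [::] gram_tbl i) j.
Proof.
have c1 : - cos (pi / 1 : R) = 1 by rewrite divr1 cospi opprK.
have c2 : - cos (pi / 2 : R) = 0 by rewrite cos_pihalf oppr0.
have c3 := cos_pi3 R.
have c4 : - cos (pi / 4 : R) = - (s / 2) by rewrite /sqrt2; field.
have c5 : - cos (pi / 5 : R) = - (phi / 2) by rewrite /golden; field.
rewrite mxE; case: i => [[|[|[|[|[|//]]]]] li]; case: j => [[|[|[|[|[|//]]]]] lj];
  rewrite /coxeter_mx /= -?(inj_eq val_inj) /= ?c1 ?c2 ?c3 ?c4 ?c5 //.
Qed.

Definition zphiR (x : zphi) : R := x.1%:~R + x.2%:~R * phi.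

Definition coef (z : root4) : seq R :=
  let: (z1, z2, z3, z4) := z in
  [:: 1; s * zphiR z1; s * zphiR z2; s * zphiR z3; s * zphiR z4].

Definition root (u : V600) : root4 := nth root0 roots u.

(** A vector is stored by its pairings with the a_j and a root by its coefficients on them, so this
    sum is the bilinear form of the two. *)
Definition pairing (z : root4) (x : 'rV[R]_5) : R :=
  \sum_(j < 5) x 0 j * (coef z)`_j.

Definition pr (u : V600) : 'rV[R]_5 -> R := pairing (root u).

Definition rt (u : V600) : 'rV[R]_5 := \sum_(j < 5) (coef (root u))`_j *: row j gram.

Definition x0 : 'rV[R]_5 := \row_j (j == 0 :> nat)%:R.

Lemma root_rf (i : 'I_5) u : root (rf i u) = root_refl i (root u).
Proof.
rewrite /root val_rf.
have : all (fun i : nat => all (fun u : nat => nth root0 roots (refln i u)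
   == root_refl i (nth root0 roots u)) (iota 0 120)) (iota 0 5) by vm_compute.
by move=> /all_ltn/(_ i)/all_ltn/(_ u)/eqP.
Qed.

Lemma coef_refl (i : 'I_5) z (j : nat) : i != 0 ->
  (coef (root_refl i z))`_j
  = (coef z)`_j - (j == i)%:R * (2 * \sum_(k < 5) (coef z)`_k * gram k i).
Proof.
have p2 (b : R) : s * b * (phi * phi) = s * b * (phi + 1) by rewrite phi_sqr.
case: z => [[[[a1 b1] [a2 b2]] [a3 b3]] [a4 b4]].
rewrite !big_ord_recl big_ord0 !gramE.
case: i => [[|[|[|[|[|//]]]]] li] // _; case: j => [|[|[|[|[|j]]]]] //=;
  rewrite /zphiR /= ?rmorphD ?rmorphN ?rmorph1 ?rmorph0 /=; try by field.
- by have := p2 b4%:~R; lra.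
- by have := p2 b3%:~R; lra.
Qed.

Lemma gramC i j : gram i j = gram j i.
Proof.
rewrite !gramE; case: i => [[|[|[|[|[|//]]]]] li];
  by case: j => [[|[|[|[|[|//]]]]] lj].
Qed.

Lemma pairingB z a x y : pairing z (x - a *: y) = pairing z x - a * pairing z y.
Proof.
rewrite /pairing mulr_sumr -sumrB; apply: eq_bigr => j _.
by rewrite !mxE mulrBl mulrA.
Qed.

Lemma pr_reflection (i : 'I_5) u x : i != 0 ->
  pr u (reflection i x) = pr (rf i u) x.
Proof.
move=> i0; rewrite /pr root_rf /reflection pairingB /pairing.
under [RHS]eq_bigr => j _ do rewrite coef_refl // mulrBr.
rewrite sumrB; congr (_ - _); rewrite [RHS](bigD1 i) //= eqxx mul1r.
rewrite [X in _ = _ + X]big1 ?addr0; last first.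
  by move=> j ji; rewrite -val_eqE in ji; rewrite (negbTE ji) mul0r mulr0.
rewrite -mulrA [RHS]mulrCA; congr (2 * (_ * _)); apply: eq_bigr => j _.
by rewrite mxE gramC mulrC.
Qed.

Lemma rt_rf (i : 'I_5) u : i != 0 -> rt (rf i u) = reflection i (rt u).
Proof.
move=> i0; rewrite /rt root_rf /reflection.
under eq_bigr => j _ do rewrite coef_refl // scalerBl.
rewrite sumrB; congr (_ - _); rewrite (bigD1 i) //= eqxx mul1r.
rewrite [X in _ + X]big1 ?addr0; last first.
  by move=> j ji; rewrite -val_eqE in ji; rewrite (negbTE ji) mul0r scale0r.
congr (2 * _ *: _); rewrite summxE; apply: eq_bigr => j _.
by rewrite !mxE.
Qed.

Definition v0 : V600 := inord 0.

Lemma root_v0 : root v0 = root0.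
Proof. by rewrite /root inordK. Qed.

Lemma pr_v0 x : pr v0 x = x 0 0.
Proof.
rewrite /pr root_v0 /pairing !big_ord_recl big_ord0 /= /zphiR /=.
by rewrite !mul0r !addr0 !mulr0 !addr0 mulr1.
Qed.

Lemma rt_v0 : rt v0 = row 0 gram.
Proof.
rewrite /rt root_v0 !big_ord_recl big_ord0 /= /zphiR /=.
by rewrite !mul0r !addr0 !mulr0 !scale0r !addr0 scale1r.
Qed.

Lemma reflection0 x : reflection ord0 x = refl rt pr v0 x.
Proof. by rewrite /reflection /refl pr_v0 rt_v0. Qed.

Lemma rt_0 u : rt u 0 0 = 1 - zphiR (root u).1.1.1.
Proof.
rewrite /rt summxE.
under eq_bigr => j _ do rewrite mxE [row _ _ _ _]mxE gramE.
rewrite !big_ord_recl big_ord0 /=.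
case: (root u) => [[[z1 z2] z3] z4] /=.
rewrite !mulr0 !addr0 mul1r mulrN.
have -> : s * zphiR z1 * (s / 2) = s * s * zphiR z1 / 2 by field.
by rewrite sqrt2_sqr; field.
Qed.

Lemma rfs_decomp (h : seq 'I_5) x u : ord0 \notin h ->
  pr u (foldr reflection x h) = pr (rfs (rev h) u) x.
Proof.
elim: h u => //= i h ih u; rewrite inE negb_or => /andP[i0 h0].
by rewrite pr_reflection 1?eq_sym // ih // rev_cons -cats1 rfs_cat.
Qed.

Lemma rt_rfs (h : seq 'I_5) u : ord0 \notin h ->
  rt (rfs h u) = foldr reflection (rt u) h.
Proof.
elim: h => //= i h ih; rewrite inE negb_or => /andP[i0 h0].
by rewrite rt_rf 1?eq_sym // ih.
Qed.

Lemma pr_rfs h u v : ord0 \notin h -> pr (rfs h u) (rt (rfs h v)) = pr u (rt v).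
Proof. by move=> h0; rewrite rt_rfs // rfs_decomp // rfs_rev. Qed.

Lemma rel_base (P : V600 -> V600 -> Prop) :
  (forall h u v, ord0 \notin h -> P u v -> P (rfs h u) (rfs h v)) ->
  (forall v, P v0 v) -> forall u v, P u v.
Proof.
move=> Ph P0 u v; have [//|//|h h0 [uE]] := @clique_trans [:: u].
by rewrite uE -(rfs_revK h v); apply: Ph => //; apply: P0.
Qed.

Lemma pr_v0_rt v :
  [/\ v0 == v -> pr v0 (rt v) = 1, adj v0 v -> pr v0 (rt v) = 0
    & v0 != v -> ~~ adj v0 v -> pr v0 (rt v) <= -1].
Proof.
rewrite pr_v0 rt_0.
(* The pairing is 1 - (a + b phi), with a + b phi the first coordinate of the root; since phi >= 1,
   the integer conditions b >= 0 and a + b >= 2 bound it by -1. *)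
have : all (fun n : nat => let z := (nth root0 roots n).1.1.1 in
    [&& (n == 0%N) ==> (z == (0, 0)), adjn 0 n ==> (z == (1, 0)) &
     [|| n == 0%N, adjn 0 n | (0 <= z.2) && (2 <= z.1 + z.2)]]) (iota 0 120).
  by vm_compute.
have -> : (v0 == v) = (val v == 0%N) by rewrite eq_sym -val_eqE /= inordK.
have -> : adj v0 v = adjn 0 v by rewrite /adj inordK.
move=> /all_ltn/(_ v); rewrite -/(root v); set z := _.1 => /and3P[].
move=> /implyP z0 /implyP z1 /or3P z2; split.
- by move=> /z0/eqP->; rewrite /zphiR mul0r addr0 subr0.
- by move=> /z1/eqP->; rewrite /zphiR mul0r addr0 subrr.
- move=> /negbTE n0 /negbTE n1; case: z2; rewrite ?n0 ?n1 // => /andP[b0 ab].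
  rewrite /zphiR; have := phi_ge1 R.
  have : 0 <= z.2%:~R :> R by rewrite ler0z.
  have : 2 <= (z.1 + z.2)%:~R :> R by rewrite (ler_int _ 2).
  rewrite rmorphD /=; nra.
Qed.

Lemma two_far u :
  exists v w : V600, [/\ v != w, u != v, u != w, ~~ adj u v & ~~ adj u w].
Proof.
have : all (fun n => (1 < count (fun i => (n != i) && ~~ adjn n i) (iota 0 120))%N)
  (iota 0 120) by vm_compute.
move=> /all_ltn/(_ u); rewrite -card_count => /card_gt1P[v [w [+ + vw]]].
by rewrite !inE => /andP[uv auv] /andP[uw auw]; exists v, w.
Qed.

Lemma mosaic_ra : right_angled adj rt pr x0.
Proof.
split.
- exact: adjC.
- exact: adjxx.
- by move=> t a x y; apply: pairingB.
- suff h : forall u v, u == v -> pr u (rt v) = 1 by move=> t; apply: h.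
  apply: rel_base => [h u v h0 e|v]; last by case: (pr_v0_rt v).
  by rewrite (inj_eq (@rfs_inj h)) pr_rfs.
- apply: rel_base => [h u v h0 e|v]; first by rewrite adj_rfs pr_rfs.
  by case: (pr_v0_rt v).
- apply: rel_base => [h u v h0 e|v].
    by rewrite (inj_eq (@rfs_inj h)) adj_rfs pr_rfs.
  by case: (pr_v0_rt v).
- move=> t; rewrite /pr /pairing big_ord_recl mxE /= big1 ?addr0.
    by case: (root t) => [[[z1 z2] z3] z4]; rewrite mul1r.
  by move=> j _; rewrite mxE mul0r.
- exact: two_far.
Qed.

(** * The full symmetry group of the mosaic, and cells as cliques at vertices *)

Local Notation act := (act rt pr).
Local Notation cell := (clique_point rt x0).
Local Notation L h x := (foldr reflection x h).

Lemma reflection_linear i a x y :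
  reflection i (a *: x + y) = a *: reflection i x + reflection i y.
Proof.
rewrite /reflection !mxE scalerBr scalerA mulrDr scalerDl opprD addrACA.
by rewrite [2 * (a * _)]mulrCA.
Qed.

Lemma L_linear h a x y : L h (a *: x + y) = a *: L h x + L h y.
Proof. by elim: h => //= i h ->; rewrite reflection_linear. Qed.

Lemma L0 h : L h 0 = 0.
Proof. by have := L_linear h (-1) 0 0; rewrite scaler0 addr0 scaleN1r addNr. Qed.

Lemma LZ h a x : L h (a *: x) = a *: L h x.
Proof. by rewrite -[a *: x]addr0 L_linear L0 addr0. Qed.

Lemma LD h x y : L h (x + y) = L h x + L h y.
Proof. by rewrite -{1}[x]scale1r L_linear scale1r. Qed.

Lemma reflectionK i : involutive (reflection i).
Proof.
move=> x; rewrite {1}/reflection {2}/reflection !mxE /reflection.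
have -> : - cos (pi / (coxeter_mx i i)%:R) = 1 :> R.
  by rewrite /coxeter_mx eqxx divr1 cospi opprK.
rewrite mulr1 (_ : 2 * (_ - _) = - (2 * x 0 i)); last by ring.
by rewrite scaleNr opprK subrK.
Qed.

Lemma L_rev h x : L h (L (rev h) x) = x.
Proof.
elim/last_ind: h x => // h i ih x.
by rewrite rev_rcons /= -cats1 foldr_cat /= reflectionK ih.
Qed.

Lemma L_x0 h : ord0 \notin h -> L h x0 = x0.
Proof.
elim: h => //= i h ih; rewrite inE negb_or => /andP[i0 /ih->].
rewrite -val_eqE /= eq_sym in i0.
by rewrite /reflection mxE (negbTE i0) mulr0 scale0r subr0.
Qed.

Lemma reflection_act (i : 'I_5) z x : i != 0 ->
  reflection i (act z x) = act (map (rf i) z) (reflection i x).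
Proof.
move=> i0; elim: z x => //= t z ih x; rewrite ih; congr act.
rewrite /refl rt_rf // pr_reflection // rfK -scaleNr addrC reflection_linear.
by rewrite scaleNr addrC.
Qed.

Lemma L_act h z x : ord0 \notin h -> L h (act z x) = act (map (rfs h) z) (L h x).
Proof.
elim: h => /= [|i h ih]; first by rewrite map_id.
rewrite inE negb_or => /andP[i0 /ih->].
by rewrite reflection_act 1?eq_sym // -map_comp.
Qed.

Lemma L_cell h (A : {set V600}) : ord0 \notin h -> L h (cell A) = cell (rfs h @: A).
Proof.
move=> h0; rewrite /clique_point -[- _]scaleN1r addrC L_linear scaleN1r addrC L_x0 //.
congr (_ - _); rewrite big_imset /=; last by move=> u v _ _; apply: rfs_inj.
rewrite (big_morph (fun x => L h x) (LD h) (L0 h)).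
by apply: eq_bigr => v _; rewrite rt_rfs.
Qed.

(** [4,3,3,5] is the semidirect product of the right-angled group and of the group [3,3,5] of
    generators 1 to 4, which fixes [x0]: generator i passes a word by renaming its letters with
    [rf i]. *)
Lemma flag_split (w : seq 'I_5) :
  exists z h, ord0 \notin h /\ forall x, L w x = act z (L h x).
Proof.
elim: w => [|i w [z [h [h0 e]]]]; first by exists [::], [::].
case: (eqVneq i ord0) => [->|i0].
  exists (z ++ [:: v0]), h; split=> // x.
  by rewrite /= e reflection0 act_cat.
exists (map (rf i) z), (i :: h); split=> [|x].
  by rewrite inE negb_or eq_sym i0.
by rewrite /= e reflection_act.
Qed.

Lemma flag_join z h : ord0 \notin h -> exists w, forall x, L w x = act z (L h x).
Proof.
move=> h0; elim/last_ind: z => [|z t [w e]]; first by exists h.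
(* The letter t is reflection 0 conjugated by a symmetry g that carries [v0] to t. *)
have [//|//|g g0 [tE]] := @clique_trans [:: t].
exists (g ++ ord0 :: rev g ++ w) => x.
rewrite foldr_cat /= foldr_cat e reflection0 -[refl _ _ _ _]/(act [:: v0] _).
by rewrite L_act // L_rev -cats1 act_cat /= tE.
Qed.

(** The ratios between the unit row k, which [flag] takes as centre of the base k-cell, and the
    projection [clique_point]. They depend on the dimension only. *)
Definition scale k : R := nth 0 [:: 1; s; s; s; s / golden R] k.

Lemma scale_neq0 k : (k <= 4)%N -> scale k != 0.
Proof.
have s0 : s != 0 by rewrite gt_eqF // sqrt2_gt0.
have p0 : golden R != 0 by rewrite gt_eqF // phi_gt0.
case: k => [|[|[|[|[|//]]]]] _ /=; rewrite ?oner_eq0 //.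
by rewrite mulf_neq0 // invr_eq0.
Qed.

(* The centre of the cell spanned at the vertex [act z x0] by the edges in the
   directions of [A]. *)
Definition centre z (A : {set V600}) := scale #|A| *: act z (cell A).

Lemma flag_base k : (k <= 4)%N -> flag R [::] k = centre [::] [set x in take k base].
Proof.
move=> k4; have ub : uniq (take k base) by apply: take_uniq; apply: (pairwise_uniq_adj base_clique).
rewrite /centre cardsE (card_uniqP ub) size_takel ?size_base // /clique_point.
rewrite (eq_bigl (mem (take k base))) => [|x]; last by rewrite inE.
rewrite -big_uniq //=.
have s2 := sqrt2_sqr R; have q2 : s / golden R * golden R * s = 2.
  by rewrite divfK ?gt_eqF ?phi_gt0.
have s3 q : q * (s * s) = q * 2 by rewrite s2.
have {}s3 := (s3 s, s3 (s / golden R)).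
have rtE (u : V600) j : rt u 0 j = \sum_(i < 5) (coef (root u))`_i * gram i j.
  by rewrite /rt summxE; apply: eq_bigr => i _; rewrite !mxE.
have rootE (n : nat) : (n < 120)%N -> root (inord n) = nth root0 roots n.
  by move=> n120; rewrite /root inordK.
apply/rowP => j; case: k k4 {ub} => [|[|[|[|[|//]]]]] _;
  rewrite /base /= ?big_cons ?big_nil !mxE ?rtE ?rootE // ?big_ord_recl ?big_ord0;
  rewrite ?gramE; case: j => [[|[|[|[|[|//]]]]] lj];
  rewrite /= /zphiR /scale /= ?mulr0z ?mulr1z ?mul0r ?mulr0 ?mul1r ?mulr1 ?addr0 ?add0r ?subr0;
  by have := s3.1; have := s3.2; lra.
Qed.

Lemma flag_L w k : flag R w k = L w (flag R [::] k). Proof. by []. Qed.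

Lemma centre_base z h k : ord0 \notin h -> (k <= 4)%N ->
  act z (L h (flag R [::] k)) = centre z [set x in take k (map (rfs h) base)].
Proof.
move=> h0 k4; rewrite flag_base // /centre /= LZ (actZ mosaic_ra) L_cell //.
suff -> : [set x in take k (map (rfs h) base)] = rfs h @: [set x in take k base].
  by rewrite card_imset //; apply: rfs_inj.
apply/setP => x; rewrite -map_take inE; apply/mapP/imsetP => -[y yb ->]; exists y => //;
  by move: yb; rewrite inE.
Qed.

Lemma flag_centre w : exists z s,
  [/\ pairwise adj s, size s = 4 & forall k, (k <= 4)%N ->
    flag R w k = centre z [set x in take k s]].
Proof.
have [z [h [h0 e]]] := flag_split w; exists z, (map (rfs h) base); split=> //.
  have := base_clique; rewrite pairwise_map; apply: sub_pairwise => u v /=.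
  by rewrite adj_rfs.
by move=> k k4; rewrite flag_L e centre_base.
Qed.

Lemma centre_flag z s : pairwise adj s -> size s = 4 ->
  exists w, forall k, (k <= 4)%N -> flag R w k = centre z [set x in take k s].
Proof.
move=> ss s4; have [|h h0 sE] := clique_trans ss; first by rewrite s4.
have [w e] := flag_join z h0; exists w => k k4.
by rewrite flag_L e centre_base // sE s4.
Qed.

Lemma card_take k (s : seq V600) : uniq s -> (k <= size s)%N ->
  #|[set x in take k s]| = k.
Proof.
by move=> us ks; rewrite cardsE (card_uniqP (take_uniq _ us)) size_takel.
Qed.

Lemma cliq_take k (s : seq V600) : pairwise adj s -> cliq [set x in take k s].
Proof.
move=> ss; apply: cliq_seq; move: ss.
by rewrite -{1}(cat_take_drop k s) pairwise_cat => /and3P[].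
Qed.

(** Flags are ordered tetrahedra at a vertex, and a chain of two cliques always extends to one,
    listed as A, then B without A, then the rest. *)
Lemma incidentP j k x y : (j <= k <= 4)%N ->
  incident j k x y <-> exists (z : seq V600) (A B : {set V600}),
    [/\ A \subset B, cliq B, #|A| = j & #|B| = k] /\
    x = centre z A /\ y = centre z B.
Proof.
move=> /andP[jk k4]; have j4 := leq_trans jk k4; split.
  move=> [w [-> ->]]; have [z [s [ss s4 e]]] := flag_centre w.
  have us := pairwise_uniq_adj ss.
  exists z, [set x in take j s], [set x in take k s]; rewrite !e //.
  split=> //; split; rewrite ?card_take ?s4 //; last exact: cliq_take.
  apply/subsetP => u; by rewrite !inE -(subnKC jk) takeD mem_cat => ->.
move=> [z [A [B [[AB cB Aj Bk] [-> ->]]]]].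
have [C [BC cC C4]] := cliq_complete cB.
pose s := enum A ++ enum (B :\: A) ++ enum (C :\: B).
have memC u : (u \in s) = (u \in C).
  rewrite !mem_cat !mem_enum !inE; case: (boolP (u \in A)) => [/(subsetP AB)/(subsetP BC)->//|_] /=.
  by case: (boolP (u \in B)) => [/(subsetP BC)->|_] /=.
have us : uniq s.
  rewrite !cat_uniq !enum_uniq /= andbT; apply/andP; split.
    apply/hasPn => u; rewrite mem_cat !mem_enum !inE => /orP[/andP[]//|/andP[uB _]].
    by apply: contra uB; apply: (subsetP AB).
  by apply/hasPn => u; rewrite !mem_enum !inE => /andP[/negbTE->]; rewrite andbF.
have ss : pairwise adj s.
  have /cliqP cC' := cC; apply/(pairwiseP ord0) => a b; rewrite !inE => aS bS ab.
  by apply: cC'; rewrite -?memC ?mem_nth // nth_uniq // ltn_eqF.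
have s4 : size s = 4 by rewrite -(card_uniqP us) (eq_card memC).
have [w e] := centre_flag z ss s4; exists w; rewrite !e //.
have -> : [set x in take j s] = A.
  by apply/setP => u; rewrite inE take_size_cat ?mem_enum // -cardE.
suff -> : [set x in take k s] = B by [].
apply/setP => u; rewrite inE /s catA take_size_cat ?mem_cat ?mem_enum ?inE.
  by case: (boolP (u \in A)) => [/(subsetP AB)->|].
by rewrite size_cat -!cardE cardsD (setIidPr AB) Aj Bk subnKC.
Qed.

End Roots.

(** * Transitions between the vertex types *)

(* The type of a vertex with [dn] incoming edges whose link in the part is the
   star of a simplex with [sn] vertices. *)
Definition type_of (t : vertex_type) (dn sn : nat) : bool :=
  match t with
  | T1 => 2 < sn
  | TA => (sn == 2) && (dn == 2)
  | TB => (sn == 2) && (dn == 1)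
  | TC => (sn == 1) && (dn == 3)
  | TD => (sn == 1) && (dn == 2)
  | TE => (sn == 1) && (dn == 1)
  | TF => (sn == 0) && (dn == 4)
  | TG => (sn == 0) && (dn == 3)
  | TH => (sn == 0) && (dn == 2)
  | TK => (sn == 0) && (dn == 1)
  end.

(** The coefficients of the recurrences: each pair holds the number of letters that turn a vertex of
    the listed type into one of type t. *)
Definition predecessors (t : vertex_type) : seq (nat * vertex_type) :=
  match t with
  | T1 => [:: (1, T1)]
  | TA => [:: (2, TA); (2, TB); (3, T1)]
  | TB => [:: (1, TA); (2, TB)]
  | TC => [:: (2, TA); (3, TC); (2, TD)]
  | TD => [:: (2, TB); (3, TC); (4, TD); (5, TE)]
  | TE => [:: (3, TC); (4, TD); (6, TE)]
  | TF => [:: (1, TC); (4, TF); (2, TG)]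
  | TG => [:: (1, TD); (6, TF); (6, TG); (5, TH)]
  | TH => [:: (1, TE); (12, TF); (12, TG); (12, TH); (12, TK)]
  | TK => [:: (94, TF); (97, TG); (101, TH); (107, TK)]
  end.

Definition succ_ok (t : vertex_type) (s1 s2 : seq V600) (u : V600) : bool :=
  [&& u \notin s1, all (fun x => (u == x) || adj u x) s2 &
      type_of t (count (adj u) s1).+1 (size s2 - (u \in s2))].

Lemma succ_ok_rfs t h s1 s2 u :
  succ_ok t (map (rfs h) s1) (map (rfs h) s2) (rfs h u) = succ_ok t s1 s2 u.
Proof.
have hI := @rfs_inj h; rewrite /succ_ok !(mem_map hI) all_map count_map size_map.
congr [&& _, _ & type_of _ _.+1 _].
  by apply: eq_all => x /=; rewrite (inj_eq hI) adj_rfs.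
by apply: eq_count => x /=; rewrite adj_rfs.
Qed.

(** Descents and boundary directions together form a clique, so up to symmetry they are the first k
    and the next j base vertices, and few cases remain. The condition on k leaves out V0, whose four
    successors of type 1 do not fit the recurrence. *)
Lemma succ_count_base t k j : (0 < k)%N -> (k + j <= 4)%N ->
  #|[pred u | succ_ok t (take k base) (drop k (take (k + j) base)) u]|
  = \sum_(c <- predecessors t) c.1 * type_of c.2 k j.
Proof.
move=> k0 kj4; pose okn (t : vertex_type) (s1 s2 : seq nat) (n : nat) :=
  [&& n \notin s1, all (fun m => (n == m) || adjn n m) s2 &
      type_of t (count (adjn n) s1).+1 (size s2 - (n \in s2))].
have iotaE a b : (a + b <= 4)%N -> iota a b = map val (drop a (take (a + b) base)).
  move=> ab; have sz : size (drop a (take (a + b) base)) = b.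
    by rewrite size_drop size_takel // addKn.
  apply: (@eq_from_nth _ 0) => [|i]; first by rewrite size_map size_iota sz.
  rewrite size_iota => ib; rewrite nth_iota // (nth_map ord0) ?sz //.
  by rewrite nth_drop nth_take ?ltn_add2l //= nth_base // (leq_trans _ ab) // ltn_add2l.
have -> : #|[pred u | succ_ok t (take k base) (drop k (take (k + j) base)) u]|
    = count (okn t (iota 0 k) (iota k j)) (iota 0 120).
  rewrite -card_count; apply: eq_card => u; rewrite !inE /succ_ok /okn.
  rewrite (iotaE 0 k) ?(leq_trans (leq_addr j k)) // (iotaE k j) // drop0.
  by rewrite !(mem_map val_inj) all_map count_map size_map.
have : all (fun k => all (fun j => count (okn t (iota 0 k) (iota k j)) (iota 0 120)
    == sumn [seq c.1 * type_of c.2 k j | c <- predecessors t]) (iota 0 (5 - k)))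
  (iota 1 4) by rewrite /okn; case: t; vm_compute.
have kI : k \in iota 1 4 by rewrite mem_iota; lia.
have jI : j \in iota 0 (5 - k) by rewrite mem_iota; lia.
move=> /allP/(_ k kI)/allP/(_ j jI)/eqP->.
by rewrite sumnE big_map.
Qed.

Lemma succ_count t s1 s2 : pairwise adj (s1 ++ s2) -> (0 < size s1)%N ->
  #|[pred u | succ_ok t s1 s2 u]|
  = \sum_(c <- predecessors t) c.1 * type_of c.2 (size s1) (size s2).
Proof.
move=> ss s1_gt0; have s4 := clique_size ss; have [h _ sE] := clique_trans ss s4.
move: sE; rewrite size_cat in s4 * => sE.
have s1E : s1 = map (rfs h) (take (size s1) base).
  have := congr1 (take (size s1)) sE; rewrite take_size_cat // -map_take.
  by rewrite take_takel // leq_addr.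
have s2E : s2 = map (rfs h) (drop (size s1) (take (size s1 + size s2) base)).
  by have := congr1 (drop (size s1)) sE; rewrite drop_size_cat // -map_drop.
rewrite -(succ_count_base t s1_gt0 s4) -sum1_card (reindex_inj (@rfs_inj h)) /=.
rewrite -sum1_card; apply: eq_bigl => u.
by rewrite !inE {1}s1E {1}s2E succ_ok_rfs.
Qed.

Lemma succ_count_sets t (A S : {set V600}) :
  cliq (A :|: S) -> [disjoint A & S] -> (0 < #|A|)%N ->
  #|[pred u : V600 | [&& u \notin A, [forall x in S, (u == x) || adj u x] &
      type_of t #|u |: A :&: [set v | adj u v]| #|S :\ u|]]|
  = \sum_(c <- predecessors t) c.1 * type_of c.2 #|A| #|S|.
Proof.
move=> cAS dAS A0; have ss : pairwise adj (enum A ++ enum S).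
  have us : uniq (enum A ++ enum S).
    rewrite cat_uniq !enum_uniq /= andbT; apply/hasPn => x; rewrite !mem_enum => xS.
    by apply/negP => xA; have /pred0P/(_ x) := dAS; rewrite /= xA xS.
  apply/(pairwiseP ord0) => i j iS jS ij; apply: (cliq_adj cAS).
  - by rewrite in_setU -(mem_enum A) -(mem_enum S) -mem_cat mem_nth.
  - by rewrite in_setU -(mem_enum A) -(mem_enum S) -mem_cat mem_nth.
  - by rewrite nth_uniq // ltn_eqF.
rewrite [in RHS]cardE [in RHS](cardE S) -(succ_count t ss); last by rewrite -cardE.
apply: eq_card => u; rewrite !inE /succ_ok mem_enum; case: (boolP (u \in A)) => //= uA.
congr (_ && type_of _ _ _).
- by apply/idP/idP => [/forall_inP h|/allP h]; [apply/allP|apply/forall_inP] => x xS;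
    apply: h; move: xS; rewrite mem_enum.
- rewrite cardsU1 !inE (negbTE uA) /= add1n; congr _.+1.
  rewrite -size_filter -(card_uniqP (filter_uniq (adj u) (enum_uniq A))).
  by apply: eq_card => x; rewrite !inE mem_filter (mem_enum A) andbC.
- by rewrite mem_enum -cardE (cardsD1 u S) addKn.
Qed.

(** * The Pascal simplex *)

Section Simplex.
Local Open Scope ring_scope.
Variables (R : realType) (z0 : seq V600) (tau : {set V600}).
Hypothesis tau_tetra : tetra tau.

Let ra := mosaic_ra R.

Local Notation act := (act (rt R) (@pr R)).
Local Notation cell := (clique_point (rt R) (x0 R)).
Local Notation D := (descent adj set0).
Local Notation asc := (ascending adj set0).
Local Notation eqw w w' := (act w =1 act w').
Local Notation wall := (root_pairing (rt R) (@pr R) (x0 R)).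

Implicit Types (t u v : V600) (w z s : seq V600) (A B K : {set V600}).
Implicit Types (x y C : 'rV[R]_5).

(* The word [z0] carries the base vertex to V0, and the cube of the tetrahedron
   [tau] at the base vertex to C0. *)
Definition ctr w A : 'rV[R]_5 := centre R (w ++ z0) A.

Definition vt w : 'rV[R]_5 := ctr w set0.

Lemma act_z0 w x : act (w ++ z0) x = act z0 (act w x).
Proof. exact: act_cat. Qed.

Lemma vtE w : vt w = act z0 (act w (x0 R)).
Proof.
by rewrite /vt /ctr /centre cards0 scale1r act_z0 /clique_point big_set0 subr0.
Qed.

Lemma ctrE w A : ctr w A = scale R #|A| *: act z0 (act w (cell A)).
Proof. by rewrite /ctr /centre act_z0. Qed.

Lemma ctr_eqw w w' A : eqw w w' -> ctr w A = ctr w' A.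
Proof. by move=> e; rewrite !ctrE e. Qed.

Lemma vt_eqw w w' : eqw w w' -> vt w = vt w'.
Proof. exact: ctr_eqw. Qed.

Lemma vt_inj w w' : vt w = vt w' -> eqw w w'.
Proof. by rewrite !vtE => /(act_inj ra)/(act_x0_inj ra). Qed.

Lemma cliq_is_clique A : cliq A -> is_clique adj A.
Proof. by move=> /cliqP. Qed.

Lemma ctr_inj w w' A A' : cliq A -> cliq A' -> #|A| = #|A'| ->
  ctr w A = ctr w' A' ->
  A = A' /\ exists2 z, {subset z <= A} & eqw w' (z ++ w).
Proof.
move=> cA cA' AA'; rewrite !ctrE -AA'.
move=> /(scalerI (scale_neq0 R (cliq_card cA)))/(act_inj ra).
by move=> /(cell_inj ra (cliq_is_clique cA) (cliq_is_clique cA')).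
Qed.

Lemma ctr_stab w z A : cliq A -> {subset z <= A} -> ctr (z ++ w) A = ctr w A.
Proof.
by move=> cA zA; rewrite !ctrE act_cat (act_cell ra (cliq_is_clique cA) zA).
Qed.

Lemma incident_ctr j k w A B : A \subset B -> cliq B -> #|A| = j -> #|B| = k ->
  incident j k (ctr w A) (ctr w B).
Proof.
move=> AB cB Aj Bk; have kj : (j <= k <= 4)%N.
  by rewrite -Aj -Bk subset_leq_card ?cliq_card.
by apply/(incidentP _ _ kj); exists (w ++ z0), A, B.
Qed.

Lemma incidentE j k x y : (j <= k <= 4)%N -> incident j k x y ->
  exists w A B, [/\ asc w, A \subset B, cliq B, #|A| = j & #|B| = k] /\
    (x = ctr w A /\ y = ctr w B).
Proof.
move=> kj /(incidentP _ _ kj)[z [A [B [[AB cB Aj Bk] [-> ->]]]]].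
have [w [aw e _]] := asc_reduce ra (z ++ rev z0).
have ez X : centre R z X = ctr w X.
  by rewrite ctrE /centre -e act_cat (act_revK ra).
by exists w, A, B; rewrite !ez.
Qed.

Lemma incident_above j k w A y : (j <= k <= 4)%N -> cliq A -> #|A| = j ->
  incident j k (ctr w A) y ->
  exists B, [/\ A \subset B, cliq B, #|B| = k & y = ctr w B].
Proof.
move=> kj cA Aj /(incidentE kj)[w' [A' [B [[_ AB cB Aj' Bk] [e ->]]]]].
have [|AA' [z zA ez]] := ctr_inj cA (cliq_sub AB cB) _ e; first by rewrite Aj.
exists B; split; rewrite // ?AA' // (ctr_eqw _ ez) ctr_stab // => u uz.
by apply: (subsetP AB); rewrite -AA' zA.
Qed.

Lemma cliq0 : cliq set0.
Proof. by apply/cliqP => u v; rewrite inE. Qed.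

Lemma incident_vt k w y : (k <= 4)%N -> incident 0 k (vt w) y ->
  exists B, [/\ cliq B, #|B| = k & y = ctr w B].
Proof.
move=> k4 /(incident_above (k := k) _ cliq0 (cards0 _))[//|B [_ cB Bk yE]].
by exists B.
Qed.

Lemma vt_incident k w B : (k <= 4)%N -> cliq B -> #|B| = k ->
  incident 0 k (vt w) (ctr w B).
Proof. by move=> k4 cB Bk; apply: incident_ctr; rewrite ?sub0set ?cards0. Qed.

Lemma incident_below k w B x : (k <= 4)%N -> cliq B -> #|B| = k ->
  incident 0 k x (ctr w B) -> exists2 z, {subset z <= B} & x = vt (z ++ w).
Proof.
move=> k4 cB Bk /(incidentE (k4 : (0 <= k <= 4)%N)).
move=> [w' [A [B' [[_ _ cB' /cards0_eq-> Bk'] [-> e]]]]].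
have [|BB [z zB ez]] := ctr_inj cB cB' _ e; first by rewrite Bk.
by exists z => //; apply: vt_eqw.
Qed.

(** * Walks, reduced words and values *)

Lemma mosaic_adj_vt w u : mosaic_adj (vt w) (vt (u :: w)).
Proof.
split=> [/vt_inj e|].
  have /(act_inj ra) : act w (x0 R) = act w (refl (rt R) (@pr R) u (x0 R)) := e (x0 R).
  move=> /(congr1 (@pr R u)); rewrite (pr_refl ra) (ra_pr_rt ra) (ra_pr_x0 ra).
  by clear e; lra.
exists (ctr w [set u]); split; first by apply: vt_incident; rewrite ?cliq1 ?cards1.
rewrite -(ctr_stab w (cliq1 u) (z := [:: u])); last by move=> v; rewrite !inE.
by apply: vt_incident; rewrite ?cliq1 ?cards1.
Qed.

Lemma mosaic_adj_inv w y : mosaic_adj (vt w) y -> exists u, y = vt (u :: w).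
Proof.
move=> [ne [e [/incident_vt[//|A [cA A1 ->]] /incident_below]]].
move=> /(_ isT cA A1)[z zA yE].
have /cards1P[u Au] : #|A| == 1%N by rewrite A1.
have [s [us sA ez]] := clique_word ra (cliq_is_clique cA) zA.
have yE' : y = vt (s ++ w).
  by rewrite yE; apply: vt_eqw => x; rewrite !act_cat ez.
exists u; rewrite yE'; congr vt; rewrite -cat1s; congr (_ ++ _).
case: s us sA yE' {ez} => [_ _ e'|a [|b s]] /=; first by rewrite e' in ne.
  by move=> _ /(_ a); rewrite Au !inE eqxx => /(_ isT)/eqP->.
move=> /andP[+ _] sA _; have := sA a; have := sA b; rewrite Au !inE !eqxx orbT.
by move=> /(_ isT)/eqP-> /(_ isT)/eqP->; rewrite eqxx.
Qed.

Fixpoint trail w : seq 'rV[R]_5 :=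
  if w is _ :: w' then rcons (trail w') (vt w) else [::].

Lemma size_trail w : size (trail w) = size w.
Proof. by elim: w => //= u w ih; rewrite size_rcons ih. Qed.

Lemma last_trail w : last (vt [::]) (trail w) = vt w.
Proof. by case: w => //= u w; rewrite last_rcons. Qed.

Lemma vt_cons_inj w u v : vt (u :: w) = vt (v :: w) -> u = v.
Proof.
rewrite !vtE !(act_cons_x0 ra) => /(act_inj ra)/addrI/oppr_inj/eqP.
rewrite -subr_eq0 -scalerBr scaler_eq0 pnatr_eq0 /= subr_eq0 => /eqP.
by move=> /(act_inj ra)/(rt_inj ra).
Qed.

Lemma trail_inj : injective trail.
Proof.
elim=> [|u w ih] [|v w'] //=; try by move=> /(congr1 size); rewrite size_rcons.
by move=> /rcons_inj[/ih <- /vt_cons_inj ->].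
Qed.

Lemma walk_trail (E : 'rV[R]_5 -> 'rV[R]_5 -> Prop) p y :
  (forall x y, E x y -> mosaic_adj x y) -> walk E (vt [::]) p y ->
  exists2 w, p = trail w & y = vt w.
Proof.
move=> Em; elim/last_ind: p y => [|p x ih] y [].
  by move=> _ <-; exists [::].
rewrite rcons_path last_rcons => /andP[hp /asboolP hx] <-.
have [//|w pE lE] := ih (last (vt [::]) p); move: hx; rewrite lE => /Em/mosaic_adj_inv[u xE].
by exists (u :: w); rewrite //= -pE xE.
Qed.

Lemma trail_walk w : walk (@mosaic_adj R) (vt [::]) (trail w) (vt w).
Proof.
split; last exact: last_trail.
elim: w => //= u w ih; rewrite rcons_path ih last_trail; apply/asboolP.
exact: mosaic_adj_vt.
Qed.

Lemma shortest_trails w : asc w ->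
  shortest_paths (@mosaic_adj R) (vt [::]) (vt w)
  = [set p | exists w', [/\ asc w', vt w' = vt w & p = trail w']]%classic.
Proof.
move=> aw; apply/seteqP; split=> [p [pw pmin]|_ [v [av e ->]]].
  have [v pE vE] := walk_trail (fun x y h => h) pw.
  exists v; split=> //; apply: (asc_min ra) => v' e.
  have := pmin (trail v'); rewrite pE !size_trail; apply.
  by rewrite vE (vt_eqw e); apply: trail_walk.
split=> [|q /(walk_trail (fun x y h => h))[v' -> e']]; first by rewrite -e; apply: trail_walk.
rewrite !size_trail; have [v2 [av2 e2 s2]] := asc_reduce ra v'.
apply: leq_trans s2; rewrite (asc_size ra av av2) // => x.
by rewrite -e2; apply: vt_inj; rewrite e e'.
Qed.

Definition words_to n x : {set n.-tuple V600} := [set v : n.-tuple V600 | asc v && (vt v == x)].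

Lemma valueE w : asc w -> value (vt [::]) (vt w) = #|words_to (size w) (vt w)|.
Proof.
move=> aw; rewrite /value shortest_trails //.
pose F := [fset x in [seq trail v | v : _.-tuple _ <- enum (words_to (size w) (vt w))]]%fset.
have -> : [set p | exists w', [/\ asc w', vt w' = vt w & p = trail w']]%classic = [set` F]%classic.
  apply/seteqP; split=> [_ [v [av e ->]]|p] /=.
    have sv : size v == size w by apply/eqP; apply: (asc_size ra) => //; apply: vt_inj.
    rewrite !inE; apply/mapP; exists (Tuple sv) => //.
    by rewrite mem_enum inE /= av e eqxx.
  by rewrite !inE => /mapP[v]; rewrite mem_enum inE => /andP[av /eqP e] ->; exists v.
rewrite set_fsetK card_fseq undup_id ?size_map -?cardE //.
by rewrite map_inj_uniq ?enum_uniq // => u v /trail_inj/val_inj.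
Qed.

Local Notation val w := (value (vt [::]) (vt w)).

Definition cons_words n (u : V600) (v : n.-tuple V600) : n.+1.-tuple V600 := [tuple of u :: v].

Lemma cons_words_inj n u : injective (@cons_words n u).
Proof. by move=> v v' /(congr1 (fun s : _.-tuple _ => behead s))/= /val_inj. Qed.

Lemma cons_words_sub u w : asc (u :: w) ->
  cons_words u @: words_to (size w) (vt w) \subset words_to (size (u :: w)) (vt (u :: w)).
Proof.
move=> auw; case/andP: (auw) => uD aw; apply/subsetP => _ /imsetP[s + ->].
rewrite !inE /= => /andP[as_ /eqP/vt_inj e]; rewrite as_ andbT.
rewrite (descent_eqw ra as_ aw e) uD /=; apply/eqP/vt_eqw; exact: eqw_cons.
Qed.

Lemma value_cons u w : asc (u :: w) -> (val w <= val (u :: w))%N.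
Proof.
move=> auw; case/andP: (auw) => uD aw.
rewrite !valueE // -(card_imset _ (@cons_words_inj _ u)).
exact/subset_leq_card/cons_words_sub.
Qed.

(** By exchange some reduced word of the longer element ends in v, and the words obtained by
    appending u miss it. *)
Lemma value_cons_lt u v w : asc (u :: w) -> v \in D (u :: w) -> v != u ->
  (val w < val (u :: w))%N.
Proof.
move=> auw vD vu; case/andP: (auw) => uD aw.
rewrite !valueE // -(card_imset _ (@cons_words_inj _ u)); apply: proper_card.
rewrite properE cons_words_sub //=; apply/subsetPn.
have [w' [aw' sw' e]] := asc_exchange ra auw vD.
have sv : size (v :: w') == size (u :: w) by rewrite sw'.
exists (Tuple sv); first by rewrite inE [tval _]/= aw' (vt_eqw e) eqxx.
by apply/imsetP => -[s _ /(congr1 (fun s : _.-tuple _ => head u s))/= vE];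
  rewrite vE eqxx in vu.
Qed.

(* The strict inequality comes from the last step, whose endpoint has several
   incoming edges. *)
Lemma climb w B : asc w -> cliq B -> exists z,
  [/\ {subset z <= B}, asc (z ++ w), B \subset D (z ++ w), (val w <= val (z ++ w))%N
    & (1 < #|B|)%N -> ~~ (B \subset D w) -> (val w < val (z ++ w))%N].
Proof.
move: {2}(#|B :\: D w|) (leqnn #|B :\: D w|) => n.
elim: n w => [|n ih] w nB aw cB.
  have BD : B \subset D w by rewrite -setD_eq0 -cards_eq0 -leqn0.
  by exists [::]; rewrite BD.
case: (boolP (B \subset D w)) => [BD|]; first by exists [::].
move=> /subsetPn[u uB uD]; have auw : asc (u :: w) by rewrite /= uD.
have DB v : v \in B -> (v \in D (u :: w)) = (v == u) || (v \in D w).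
  move=> vB; rewrite in_descent_cons; case: (eqVneq v u) => //= vu.
  by rewrite [adj u v](cliq_adj cB) ?andbT // eq_sym.
have [|z [zB az Bz le lt]] := ih (u :: w) _ auw cB.
  rewrite -ltnS; apply: leq_trans nB; apply: proper_card; rewrite properE.
  apply/andP; split.
    apply/subsetP => v; rewrite !in_setD => /andP[vD vB]; rewrite vB andbT.
    by move: vD; rewrite DB // negb_or => /andP[].
  by apply/subsetPn; exists u; rewrite !in_setD uB ?uD // DB // eqxx.
exists (rcons z u); rewrite cat_rcons; split.
- by move=> v; rewrite mem_rcons inE => /orP[/eqP->|/zB].
- exact: az.
- exact: Bz.
- exact: leq_trans (value_cons auw) le.
move=> B1 _; case: (boolP (B \subset D (u :: w))) => BD; last first.
  by apply: leq_ltn_trans (value_cons auw) (lt B1 BD).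
apply: leq_trans le; have [v vB vu] : exists2 v, v \in B & v != u.
  have /card_gt0P[v] : (0 < #|B :\ u|)%N.
    by move: B1; rewrite (cardsD1 u) uB add1n ltnS.
  by rewrite !inE => /andP[]; exists v.
by apply: (value_cons_lt auw _ vu); apply: (subsetP BD).
Qed.

Lemma descent_cliq w : cliq (D w).
Proof. exact/cliqP/(descent_adj ra). Qed.

Lemma tetra_descent w B : tetra B -> B \subset D w -> D w = B.
Proof.
move=> /andP[_ /eqP B4] BD; apply/esym/eqP; rewrite eqEcard BD B4.
exact/cliq_card/descent_cliq.
Qed.

(** Otherwise [climb] would reach a vertex of the same hypercube with a strictly larger value. *)
Lemma largest_top w B : asc w -> tetra B ->
  largest_vertex (vt [::]) (ctr w B) (vt w) -> D w = B.
Proof.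
move=> aw tB [_ h]; have /andP[cB /eqP B4] := tB.
have [z [zB az Bz _ lt]] := climb aw cB; apply: tetra_descent => //.
case: (boolP (B \subset D w)) => // /(lt ltac:(by rewrite B4)).
rewrite ltnNge h //; rewrite -(ctr_stab w cB zB).
exact: vt_incident.
Qed.

(** The letters of B commute, so removing one leaves the other descents in B intact: from the top of
    a hypercube all its vertices are reached by downward steps, which never raise the value. *)
Lemma descend w B s : asc w -> cliq B -> B \subset D w -> uniq s -> {subset s <= B} ->
  exists w', [/\ asc w', eqw w' (s ++ w), {in B, forall v, (v \in D w') = (v \notin s)}
    & (val w' <= val w)%N].
Proof.
move=> aw cB BD; elim: s => [|u s ih].
  by exists w; split=> // v vB; rewrite (subsetP BD).
move=> /= /andP[uNs us] sB; have uB : u \in B by apply: sB; rewrite mem_head.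
have [//|v vs|w' [aw' e Dw' le]] := ih; first by apply: sB; rewrite inE vs orbT.
have uD : u \in D w' by rewrite Dw'.
have [w2 [auw2 _ e2]] := asc_exchange ra aw' uD; case/andP: (auw2) => uD2 aw2.
exists w2; split=> //.
- move=> x; rewrite -(eqw_cons2 ra u w2) -(eqw_cons u e2).
  exact: (eqw_cons u e).
- move=> v vB; rewrite inE negb_or; case: (eqVneq v u) => [->|vu] /=.
    exact: negbTE.
  rewrite -Dw' // (descent_eqw ra aw' auw2 e2) in_descent_cons (negbTE vu) /=.
  by rewrite [adj u v](cliq_adj cB) ?andbT // eq_sym.
- by apply: leq_trans le; rewrite (vt_eqw e2); apply: value_cons.
Qed.

Lemma top_largest w B : asc w -> tetra B -> B \subset D w ->
  largest_vertex (vt [::]) (ctr w B) (vt w).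
Proof.
move=> aw /andP[cB /eqP B4] BD; split; first exact: vt_incident.
move=> y /(incident_below (leqnn 4) cB B4)[z zB ->].
have [s [us sB e]] := clique_word ra (cliq_is_clique cB) zB.
have [w' [aw' e' _ le]] := descend aw cB BD us sB.
suff -> : vt (z ++ w) = vt w' by [].
by apply: vt_eqw => x; rewrite e' !act_cat e.
Qed.

(* [sg w] spans the simplex whose star is the link of the part at [vt w]. *)
Definition inside w : bool := [forall t in tau, wall t w <= 1].

Definition sg w : {set V600} := [set t in tau | wall t w == 1].

Lemma insideP w : reflect {in tau, forall t, wall t w <= 1} (inside w).
Proof. exact: forall_inP. Qed.

Lemma inside_eqw w w' : eqw w w' -> inside w = inside w'.
Proof. by move=> e; apply: eq_forallb => t; rewrite (wall_eqw _ _ e). Qed.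

Lemma sg_eqw w w' : eqw w w' -> sg w = sg w'.
Proof. by move=> e; apply/setP => t; rewrite !inE (wall_eqw _ _ e). Qed.

Lemma sg_sub w : sg w \subset tau.
Proof. by apply/subsetP => t; rewrite inE => /andP[]. Qed.

Lemma sg_cliq w : cliq (sg w).
Proof. by apply: cliq_sub (sg_sub w) _; case/andP: tau_tetra. Qed.

Lemma inside_cases w t : inside w -> t \in tau -> t \notin sg w -> wall t w <= -1.
Proof.
move=> /insideP iw tt; rewrite inE tt /= => /eqP n1; have := iw t tt.
by case: (wall_cases ra t w) => // h; lra.
Qed.

(** * Steps that stay in the part *)

Definition star w u : bool := [forall t in sg w, (u == t) || adj u t].

Lemma star_cliq w u B : cliq B -> sg w \subset B -> u \in B -> star w u.
Proof.
move=> cB SB uB; apply/forall_inP => t /(subsetP SB) tB.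
by case: eqVneq => //= ut; apply: (cliq_adj cB).
Qed.

Lemma wall_star w u t : t \in sg w -> wall t (u :: w) = 1 - 2 * pr t (rt R u).
Proof. by rewrite inE => /andP[_ /eqP]; apply: (wall1_cons ra). Qed.

(** A mirror already crossed can come back into [sg] only through its own letter. *)
Lemma star_step w u : inside w -> star w u -> inside (u :: w) /\
  sg (u :: w) \subset u |: sg w.
Proof.
move=> iw /forall_inP su; split.
  apply/insideP => t tt; case: (boolP (t \in sg w)) => ts.
    rewrite wall_star //; case/orP: (su t ts) => [/eqP->|ut].
      by rewrite (ra_pr_rt ra); lra.
    by rewrite (ra_pr_adj ra) ?mulr0 ?subr0 // adjC.
  have := inside_cases iw tt ts => /(wall_beyond_cons ra u)[|[-> _]] //; lra.
apply/subsetP => t tsu; rewrite in_setU1; case: (boolP (t \in sg w)) => [_|ts].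
  by rewrite orbT.
move: tsu; rewrite inE => /andP[tt /eqP w1].
have := inside_cases iw tt ts => /(wall_beyond_cons ra u)[|[_ ->]]; last by rewrite eqxx.
by rewrite w1 => ?; exfalso; lra.
Qed.

Lemma inside_star w u : inside w -> inside (u :: w) -> star w u.
Proof.
move=> iw /insideP iuw; apply/forall_inP => t ts.
have := iuw t (subsetP (sg_sub w) t ts); rewrite wall_star // => h.
have := relP ra t u; rewrite eq_sym adjC; case; rewrite ?orbT // => far.
by exfalso; lra.
Qed.

Lemma star_word w z B : cliq B -> inside w -> sg w \subset B -> {subset z <= B} ->
  inside (z ++ w) /\ sg (z ++ w) \subset B.
Proof.
move=> cB iw SB; elim: z => [//|u z ih] zB.
have uB : u \in B by apply: zB; rewrite mem_head.
have [|iz Sz] := ih; first by move=> v vz; apply: zB; rewrite inE vz orbT.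
have [-> S] := star_step iz (star_cliq cB Sz uB); split=> //.
by apply: subset_trans S _; rewrite subUset sub1set uB.
Qed.

Lemma inside_pred u w : asc (u :: w) -> inside (u :: w) -> inside w.
Proof.
by move=> a /insideP h; apply/insideP => t /h; apply: (asc_wall ra).
Qed.

Lemma sg_cons u w : asc (u :: w) -> inside w -> star w u -> sg (u :: w) = sg w :\ u.
Proof.
move=> a iw su; have [_ /subsetP S] := star_step iw su.
apply/setP => t; rewrite in_setD1; case: (boolP (t \in sg w)) => ts; last first.
  rewrite andbF; apply/negbTE; rewrite inE; case: (boolP (t \in tau)) => //= tt.
  have := asc_beyond ra a (inside_cases iw tt ts) => h.
  by apply/eqP => h1; lra.
rewrite andbT inE (subsetP (sg_sub w) t ts) wall_star //=.
case: (eqVneq t u) => [->|tu] /=.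
  by rewrite (ra_pr_rt ra); apply/eqP => h; lra.
have /forall_inP/(_ t ts) := su; rewrite eq_sym (negbTE tu) /= => ut.
by rewrite (ra_pr_adj ra) ?mulr0 ?subr0 ?eqxx // adjC.
Qed.

Lemma sg_letters w t u : asc w -> t \in sg w -> u \in w -> adj t u.
Proof.
move=> aw; rewrite inE => /andP[_ /eqP] /(wall1_adj ra aw)/allP; apply.
Qed.

Lemma sg_descent w t u : asc w -> t \in sg w -> u \in D w -> adj t u.
Proof. by move=> aw ts /descent_letters; apply: sg_letters. Qed.

Lemma sg_nil : sg [::] = tau.
Proof.
by apply/setP => t; rewrite inE /root_pairing (ra_pr_x0 ra) eqxx andbT.
Qed.

Lemma inside_nil : inside [::].
Proof. by apply/insideP => t _; rewrite /root_pairing (ra_pr_x0 ra). Qed.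

(** * The generated hypercubes, described vertex by vertex *)

Definition in_part C : Prop := exists w B,
  [/\ C = ctr w B, tetra B, inside w & sg w \subset B].

(** Moving along edges of the hypercube stays in the star, so the criterion can be read at any of
    its vertices. *)
Lemma part_at C w : in_part C -> incident 0 4 (vt w) C ->
  inside w /\ exists B, [/\ C = ctr w B, tetra B & sg w \subset B].
Proof.
move=> [w' [B [-> tB iw' SB]]]; have /andP[cB /eqP B4] := tB.
move=> /(incident_below (leqnn 4) cB B4)[z zB /vt_inj e].
have [iz Sz] := star_word cB iw' SB zB.
rewrite (inside_eqw e) (sg_eqw e) iz; split=> //; exists B.
by rewrite (ctr_eqw _ e) ctr_stab.
Qed.

Local Notation simplex := (in_simplex (vt [::]) (ctr [::] tau)).

Lemma simplex_sound C : simplex C -> in_part C.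
Proof.
elim=> {C} [|C x C' _ pC lx xC'|z C1 C2 C3 C _ p1 _ p2 _ p3 n12 n13 n23 z1 z2 z3 zC].
- by exists [::], tau; rewrite sg_nil inside_nil.
- have [xC _] := lx; have [w [A [B [[aw _ _ /cards0_eq-> _] [xE _]]]]] := incidentE (isT : (0 <= 4 <= 4)%N) xC.
  subst x; have [iw [B' [CE tB' SB']]] := part_at pC xC; subst C.
  have DB := largest_top aw tB' lx; have [//|B'' [cB'' B4 ->]] := incident_vt _ xC'.
  exists w, B''; split; rewrite /tetra ?cB'' ?B4 //.
  (* Members of [sg w] are adjacent to all descents; at the top the descents form a tetrahedron
     containing [sg w], so a member would be adjacent to itself. *)
  suff -> : sg w = set0 by apply: sub0set.
  apply/setP => t; rewrite [RHS]inE; apply/negbTE/negP => ts.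
  have := sg_descent aw ts; rewrite DB => /(_ t (subsetP SB' _ ts)).
  by rewrite adjxx.
have [w [A [B [[aw AB cB A2 B4] [zE CE]]]]] := incidentE (isT : (2 <= 4 <= 4)%N) zC.
subst z C; have cA := cliq_sub AB cB.
have at_ C' : in_part C' -> incident 2 4 (ctr w A) C' ->
    inside w /\ exists B', [/\ C' = ctr w B', tetra B', A \subset B' & sg w \subset B'].
  move=> pC' /(incident_above (j := 2) (k := 4) isT cA A2)[B' [AB' cB' B4' C'E]].
  have xC' : incident 0 4 (vt w) C' by rewrite C'E; apply: vt_incident.
  have [iw [B2 [C'E2 tB2 SB2]]] := part_at pC' xC'; split=> //.
  have /andP[cB2 /eqP B24] := tB2.
  have [|B'B2 _] := ctr_inj cB' cB2 _ (etrans (esym C'E) C'E2); first by rewrite B4' B24.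
  by exists B2; rewrite -B'B2 in tB2 SB2 *.
have [iw [B1 [E1 t1 A1 S1]]] := at_ _ p1 z1.
have [_ [B2 [E2 t2 A2' S2]]] := at_ _ p2 z2.
have [_ [B3 [E3 t3 A3 S3]]] := at_ _ p3 z3.
exists w, B; split; rewrite /tetra ?cB ?B4 //.
(* If t in [sg w] were outside A, the three hypercubes would share the 3-dimensional cell of t |:
   A. *)
apply: subset_trans AB; apply/subsetP => t ts; apply: contraT => tA.
pose K := t |: A; have cK : cliq K.
  apply: cliq_sub (_ : K \subset B1) _; last by case/andP: t1.
  by rewrite subUset sub1set (subsetP S1).
have K3 : #|K| = 3 by rewrite cardsU1 tA A2.
have third B' : tetra B' -> A \subset B' -> sg w \subset B' ->
    exists2 u, B' = u |: K & {in K, forall v, adj u v}.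
  move=> /andP[cB' /eqP B4'] AB' SB'.
  have KB : K \subset B' by rewrite subUset sub1set (subsetP SB').
  have [u uB uK] : exists2 u, u \in B' & u \notin K.
    apply/subsetPn; apply: contraTN isT => /subset_leq_card.
    by rewrite B4' K3.
  exists u; last first.
    move=> v vK; apply: (cliq_adj cB') => //; first exact: (subsetP KB).
    by apply: contraNneq uK => ->.
  by apply/esym/eqP; rewrite eqEcard subUset sub1set uB KB cardsU1 uK K3 B4'.
have [u1 U1 h1] := third _ t1 A1 S1; have [u2 U2 h2] := third _ t2 A2' S2.
have [u3 U3 h3] := third _ t3 A3 S3.
by exfalso; apply: (cliq3_ext cK K3 h1 h2 h3);
  [apply/eqP => e; apply: n12|apply/eqP => e; apply: n13|apply/eqP => e; apply: n23];
  rewrite ?E1 ?E2 ?E3 ?U1 ?U2 ?U3 e.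
Qed.

Lemma ctr_vt_incident w B : tetra B -> incident 0 4 (vt w) (ctr w B).
Proof. by case/andP=> cB /eqP B4; apply: vt_incident. Qed.

(* Cubes that contain an incoming edge of [vt w] are cubes of a shorter vertex.
   If the triangle K spans a cube with the incoming edge d, then the vertex of
   that cube opposite to V0 is reached from [vt w] through K, and the cubes
   above K contain it. *)
Lemma simplex_at w B : asc w -> inside w -> tetra B -> sg w \subset B ->
  simplex (ctr w B).
Proof.
move: {2}(size w) (leqnn (size w)) => n; elim: n w B => [|n ih] w B.
  rewrite leqn0 size_eq0 => /eqP-> _ _ /andP[_ /eqP B4]; rewrite sg_nil => SB.
  suff -> : B = tau by apply: in_simplex_first.
  case/andP: tau_tetra => _ /eqP t4.
  by apply/esym/eqP; rewrite eqEcard SB B4 t4.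
case: w => [|d w1] wn aw iw; first by apply: ih.
set w := d :: w1 in wn aw iw *; have dD : d \in D w by rewrite /= setU11.
have near e B' : e \in D w -> tetra B' -> sg w \subset B' -> e \in B' -> simplex (ctr w B').
  move=> eD tB' SB' eB'; have /andP[cB' _] := tB'.
  have [w' [ew' sw' e']] := asc_exchange ra aw eD; case/andP: (ew') => _ aw'.
  have E : eqw w' (e :: w) by move=> x; rewrite (eqw_cons e e') (eqw_cons2 ra).
  have [iew Sew] := star_step iw (star_cliq cB' SB' eB').
  rewrite -(ctr_stab w cB' (z := [:: e])); last by move=> v; rewrite inE => /eqP->.
  rewrite -(ctr_eqw B' E); apply: ih => //; first by rewrite -ltnS -sw'.
  - by rewrite (inside_eqw E).
  - by rewrite (sg_eqw E); apply: subset_trans Sew _; rewrite subUset sub1set eB'.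
move=> tB SB; move: B tB SB; apply: (fill_all (d := d)).
- by move=> B' tB' SB' dB'; apply: (near d).
- move=> K B cK K3 SK dK tB KB.
  case: (boolP [exists e in D w, e \in K]) => [/exists_inP[e eD eK]|/exists_inPn Kn].
    by apply: (near e) => //; [apply: subset_trans KB|apply: (subsetP KB)].
  (* Since K avoids the descents, appending its letters is ascending; d is adjacent to all of K and
     survives, so d |: K becomes the descent set. *)
  have cE := cliq_enum cK; have [||aKw DK] := asc_clique_word ra aw (enum_uniq K).
  + move=> u v; rewrite !mem_enum; exact: (cliq_adj cK).
  + by move=> u; rewrite mem_enum => uK; apply/negP => /Kn; rewrite uK.
  have tdK : tetra (d |: K) by apply: tetraU1.
  have stab B' : tetra B' -> K \subset B' -> ctr (enum K ++ w) B' = ctr w B'.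
    move=> /andP[cB' _] KB'; rewrite ctr_stab // => u; rewrite mem_enum.
    exact: (subsetP KB').
  have top : d |: K \subset D (enum K ++ w).
    apply/subsetP => u; rewrite in_setU1 DK mem_enum => /orP[/eqP->|->//].
    rewrite dD /= orbC; apply/orP; left; apply/allP => v; rewrite mem_enum; exact: dK.
  apply: (in_simplex_step (C := ctr (enum K ++ w) (d |: K)) (x := vt (enum K ++ w))).
  + rewrite stab ?subsetUr //; apply: (near d); rewrite ?setU11 //.
    by apply: subset_trans SK (subsetUr _ _).
  + exact: top_largest.
  + by rewrite -stab //; apply: ctr_vt_incident.
- move=> A B1 B2 B3 B cA A2 t1 t2 t3 tB n12 n13 n23 A1 A2' A3 AB g1 g2 g3.
  have inc B' : tetra B' -> A \subset B' -> incident 2 4 (ctr w A) (ctr w B').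
    by move=> /andP[cB' /eqP B4'] AB'; apply: incident_ctr.
  have ne B' B'' : tetra B' -> tetra B'' -> B' != B'' -> ctr w B' <> ctr w B''.
    move=> /andP[cB' /eqP B4'] /andP[cB'' /eqP B4''] /eqP ne e; apply: ne.
    by have [] := ctr_inj cB' cB'' (etrans B4' (esym B4'')) e.
  by apply: (in_simplex_convex (z := ctr w A) g1 g2 g3); auto.
- exact: sg_cliq.
- by move=> t ts; rewrite adjC; apply: (sg_descent aw).
Qed.

Lemma simplexP C : simplex C <-> in_part C.
Proof.
split; first exact: simplex_sound.
move=> [w [B [-> tB iw SB]]]; have [w' [aw' e _]] := asc_reduce ra w.
rewrite (ctr_eqw _ e); apply: simplex_at => //.
- by rewrite -(inside_eqw e).
- by rewrite -(sg_eqw e).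
Qed.

(** * Levels, incoming edges and faces *)

Local Notation sadj := (simplex_adj (vt [::]) (ctr [::] tau)).

Lemma simplex_adj_mosaic x y : sadj x y -> mosaic_adj x y.
Proof. by move=> [ne [e [_ xe ye]]]; split=> //; exists e. Qed.

Lemma simplex_adj_inside w y : sadj (vt w) y -> inside w.
Proof.
move=> [_ [e [[C /simplexP pC eC] we _]]].
have [//|A [cA A1 eE]] := incident_vt _ we; subst e.
have [B [AB cB B4 CE]] := incident_above (j := 1) (k := 4) isT cA A1 eC.
by have [] := part_at pC (w := w); rewrite ?CE //; apply: vt_incident.
Qed.

Lemma simplex_adj_sym x y : sadj x y -> sadj y x.
Proof. by move=> [ne [e [? ? ?]]]; split; [apply: nesym|exists e]. Qed.

Lemma simplex_adj_vt w u : inside w -> inside (u :: w) -> sadj (vt w) (vt (u :: w)).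
Proof.
move=> iw iuw; have [ne _] := mosaic_adj_vt w u; split=> //.
have cu : cliq (u |: sg w).
  apply/cliqP => a b; rewrite !in_setU1; have /forall_inP su := inside_star iw iuw.
  move=> /orP[/eqP->|aS] /orP[/eqP->|bS]; rewrite ?eqxx //.
  - by have := su b bS; case: eqVneq.
  - by have := su a aS; rewrite eq_sym adjC; case: eqVneq.
  - exact: (cliq_adj (sg_cliq w)).
have [B [uB cB B4]] := cliq_complete cu.
have c1 : #|[set u]| = 1%N by rewrite cards1.
exists (ctr w [set u]); split.
- exists (ctr w B); last first.
    apply: incident_ctr => //; apply: subset_trans uB; apply: subsetUl.
  apply/simplexP; exists w, B; split; rewrite /tetra ?cB ?B4 //.
  by apply: subset_trans uB; apply: subsetUr.
- by apply: vt_incident; rewrite ?cliq1.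
- rewrite -(ctr_stab w (cliq1 u) (z := [:: u])); last by move=> v; rewrite !inE.
  by apply: vt_incident; rewrite ?cliq1.
Qed.

Lemma simplex_trail w : asc w -> inside w -> walk sadj (vt [::]) (trail w) (vt w).
Proof.
move=> aw iw; split; last exact: last_trail.
elim: w aw iw => //= u w ih auw iuw; case/andP: (auw) => _ aw.
have iw := inside_pred auw iuw.
rewrite rcons_path ih // last_trail; apply/asboolP; exact: simplex_adj_vt.
Qed.

Local Notation lev := (level (vt [::]) (ctr [::] tau)).

(** Distances in the part are those of the mosaic: dropping the last letter of an ascending word
    never leaves the part. *)
Lemma levelP n x : lev n x <-> exists w, [/\ asc w, inside w, size w = n & x = vt w].
Proof.
split.
  move=> [p [pw pmin] pn]; have [w pE xE] := walk_trail simplex_adj_mosaic pw.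
  have [w' [aw' e sw']] := asc_reduce ra w.
  have iw : inside w.
    case: w pE xE {e sw'} => [|u w] pE xE; first exact: inside_nil.
    move: pw => [+ _]; rewrite pE /= rcons_path last_trail => /andP[_ /asboolP].
    by move=> /simplex_adj_sym/simplex_adj_inside.
  have iw' : inside w' by rewrite -(inside_eqw e).
  exists w'; split=> //; last by rewrite xE (vt_eqw e).
  apply/eqP; rewrite eqn_leq -{1}pn pE size_trail sw' /=.
  have := pmin (trail w'); rewrite pE !size_trail -pn pE size_trail; apply.
  by rewrite xE (vt_eqw e); apply: simplex_trail.
move=> [w [aw iw sw ->]]; exists (trail w); last by rewrite size_trail.
split=> [|q [qp ql]]; first exact: simplex_trail.
have [_ h] : shortest_paths (@mosaic_adj R) (vt [::]) (vt w) (trail w).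
  by rewrite shortest_trails //; exists w.
apply: h; split=> //; apply: sub_path qp => a b /asboolP ab.
by apply/asboolP; apply: simplex_adj_mosaic.
Qed.

Lemma level_vt n w : asc w -> lev n (vt w) <-> inside w /\ size w = n.
Proof.
move=> aw; rewrite levelP; split=> [[w' [aw' iw' sw' /vt_inj e]]|[iw sw]].
  by rewrite (inside_eqw e) (asc_size ra aw aw' e).
by exists w.
Qed.

Lemma indegree_vt w : asc w -> inside w ->
  indegree (vt [::]) (ctr [::] tau) (vt w) = #|D w|.
Proof.
move=> aw iw; pose F := [fset x in [seq vt (u :: w) | u <- enum (D w)]]%fset.
rewrite /indegree; have -> : incoming (vt [::]) (ctr [::] tau) (vt w) = [set` F]%classic.
  apply/seteqP; split=> y; rewrite /= inE.
    move=> [yw [n [yn /(level_vt _ aw)[_ wn]]]].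
    have [u yE] := mosaic_adj_inv (simplex_adj_mosaic (simplex_adj_sym yw)).
    apply/mapP; exists u => //; rewrite mem_enum; apply: contraT => uD.
    have auw : asc (u :: w) by rewrite /= uD.
    by move: yn; rewrite yE => /(level_vt _ auw)[_ /=]; lia.
  move=> /mapP[u]; rewrite mem_enum => uD ->.
  have [w' [auw' sw' e]] := asc_exchange ra aw uD; case/andP: (auw') => _ aw'.
  have E : eqw w' (u :: w) by move=> x; rewrite (eqw_cons u e) (eqw_cons2 ra).
  have iuw' : inside (u :: w') by rewrite -(inside_eqw e).
  have iw' := inside_pred auw' iuw'.
  rewrite -(vt_eqw E); split.
    by rewrite (vt_eqw e); apply: simplex_adj_vt.
  by exists (size w'); rewrite !level_vt.
rewrite set_fsetK card_fseq undup_id ?size_map -?cardE //.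
by rewrite map_inj_uniq ?enum_uniq // => u v /vt_cons_inj.
Qed.

(** The hypercubes of the part above a cell A at this vertex are the tetrahedra containing A and
    [sg w]; there is just one exactly when the union of the two is already a tetrahedron. *)
Lemma on_face_vt k w : (0 < k < 4)%N -> inside w ->
  on_face (vt [::]) (ctr [::] tau) k (vt w) <-> (4 - k <= #|sg w|)%N.
Proof.
move=> /andP[k0 k4] iw; have k4' := ltnW k4.
have kk : (k <= 4 <= 4)%N by rewrite k4'.
have above A C : cliq A -> #|A| = k -> simplex C -> incident k 4 (ctr w A) C ->
    exists B, [/\ C = ctr w B, tetra B, A \subset B & sg w \subset B].
  move=> cA Ak /simplexP pC /(incident_above kk cA Ak)[B [AB cB B4 CE]].
  have [|_ [B' [CE' tB' SB']]] := part_at (w := w) pC.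
    by rewrite CE; apply: vt_incident.
  have /andP[cB' /eqP B4'] := tB'.
  have [|BB _] := ctr_inj cB cB' _ (etrans (esym CE) CE'); first by rewrite B4 B4'.
  by exists B; rewrite -BB in tB' SB'.
have part B : tetra B -> sg w \subset B -> simplex (ctr w B).
  by move=> tB SB; apply/simplexP; exists w, B.
split.
  move=> [z /(incident_vt k4')[A [cA Ak ->]] [C [[sC iC] uniq_C]]].
  have [B [CE tB AB SB]] := above A C cA Ak sC iC.
  have cU : cliq (A :|: sg w).
    by apply: cliq_sub (_ : _ \subset B) _; [rewrite subUset AB|case/andP: tB].
  suff : (4 <= #|A :|: sg w|)%N.
    by move=> h; have := leq_trans h (leq_card_setU A (sg w)); rewrite Ak; lia.
  rewrite leqNgt; apply/negP => /(cliq_complete2 cU)[B1 [B2 [n12 [U1 U2] [c1 c2] [f1 f2]]]].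
  have eC B' : A :|: sg w \subset B' -> cliq B' -> #|B'| = 4%N -> C = ctr w B'.
    rewrite subUset => /andP[AB' SB'] cB' B4'; apply: uniq_C; split.
      by apply: part; rewrite // /tetra cB' B4'.
    exact: incident_ctr.
  have [|e _] := ctr_inj c1 c2 _ (etrans (esym (eC B1 U1 c1 f1)) (eC B2 U2 c2 f2)).
    by rewrite f1 f2.
  by rewrite e eqxx in n12.
move=> Sk; have [B [SB cB B4]] := cliq_complete (sg_cliq w).
(* Removing 4 - k boundary directions from a tetrahedron above [sg w] leaves a k-cell that belongs
   to this hypercube alone. *)
pose S' := [set x in take (4 - k) (enum (sg w))].
have S'k : #|S'| = (4 - k)%N by rewrite card_take ?enum_uniq -?cardE.
have S'S : S' \subset sg w.
  by apply/subsetP => x; rewrite inE => /mem_take; rewrite mem_enum.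
have S'B := subset_trans S'S SB.
have AB : B :\: S' \subset B := subsetDl _ _.
have Ak : #|B :\: S'| = k by rewrite cardsD (setIidPr S'B) B4 S'k subKn.
have cA := cliq_sub AB cB; have tB : tetra B by rewrite /tetra cB B4.
exists (ctr w (B :\: S')); first exact: vt_incident.
exists (ctr w B); split.
  by split; [apply: part|apply: incident_ctr].
move=> C [sC /(above _ C cA Ak sC)[B' [-> /andP[_ /eqP B4'] AB' SB']]].
suff -> : B = B' by [].
apply/eqP; rewrite eqEcard B4 B4' leqnn andbT; apply/subsetP => x xB.
case: (boolP (x \in S')) => xS; first exact: (subsetP SB' _ (subsetP S'S _ xS)).
by apply: (subsetP AB'); rewrite in_setD xS.
Qed.

Lemma has_type_vt (t : vertex_type) w : asc w -> inside w ->
  has_type (vt [::]) (ctr [::] tau) t (vt w) <-> type_of t #|D w| #|sg w|.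
Proof.
move=> aw iw; have ind := indegree_vt aw iw.
pose on k := on_face (vt [::]) (ctr [::] tau) k (vt w).
have f1 : on 1%N <-> (3 <= #|sg w|)%N := @on_face_vt 1 w isT iw.
have f2 : on 2%N <-> (2 <= #|sg w|)%N := @on_face_vt 2 w isT iw.
have f3 : on 3%N <-> (1 <= #|sg w|)%N := @on_face_vt 3 w isT iw.
have [p2 p3] : (#|sg w| == 2%N <-> (2 <= #|sg w|)%N /\ ~ (3 <= #|sg w|)%N) /\
    (#|sg w| == 1%N <-> (1 <= #|sg w|)%N /\ ~ (2 <= #|sg w|)%N) by split; split; lia.
have p0 : #|sg w| == 0%N <-> ~ (1 <= #|sg w|)%N by split; lia.
have face n (P : Prop) (b : bool) : (b <-> P) ->
    (P /\ indegree (vt [::]) (ctr [::] tau) (vt w) = n) <-> (b && (#|D w| == n)).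
  rewrite ind => e; split=> [[/e-> ->]|/andP[/e ? /eqP]] //.
  by rewrite eqxx.
case: t; rewrite /has_type /type_of /=; first exact: f1;
  by apply: face; rewrite -/(on 1%N) -/(on 2%N) -/(on 3%N); tauto.
Qed.

(** * Counting words by type *)

Definition typed_words (t : vertex_type) n : {set n.-tuple V600} :=
  [set v : n.-tuple V600 | [&& asc v, inside v & type_of t #|D v| #|sg v|]].

(** Each vertex is weighted by the number of its reduced words, so the sum counts words. *)
Lemma value_sum_words (t : vertex_type) n :
  value_sum (vt [::]) (ctr [::] tau) t n = #|typed_words t n|.
Proof.
pose F := [fset x in [seq vt v | v : n.-tuple V600 <- enum (typed_words t n)]]%fset.
have FP x : reflect (exists2 v : n.-tuple V600, v \in typed_words t n & x = vt v) (x \in F).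
  rewrite inE; apply: (iffP mapP) => -[v vg ->]; exists v => //;
    by move: vg; rewrite mem_enum.
rewrite /value_sum.
have -> : (lev n `&` has_type (vt [::]) (ctr [::] tau) t = [set` F])%classic.
  apply/seteqP; split=> x /=.
    move=> [/levelP[w [aw iw /eqP sw ->]] /(has_type_vt _ aw iw) tw].
    by apply/FP; exists (Tuple sw); rewrite // inE /= aw iw.
  move=> /FP[v]; rewrite inE => /and3P[av iv tv] ->; split; last exact/has_type_vt.
  by apply/level_vt; rewrite ?size_tuple.
rewrite fsbig_finite // set_fsetK.
have -> : (\sum_(x <- F) value (vt [::]) x
    = \sum_(x <- F) \sum_(v in typed_words t n) (vt v == x))%N.
  rewrite big_seq [RHS]big_seq; apply: eq_bigr => x /FP[v]; rewrite inE.
  move=> /and3P[av iv tv] ->; rewrite valueE // size_tuple -sum1_card.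
  rewrite [RHS](eq_bigr (fun s : n.-tuple V600 => if vt s == vt v then 1 else 0)%N).
    rewrite -big_mkcondr; apply: eq_bigl => s; rewrite !inE.
    case: eqP => [/vt_inj e|]; rewrite ?andbF // !andbT.
    case: (boolP (asc s)) => //= as_.
    by rewrite (descent_eqw ra as_ av e) (inside_eqw e) (sg_eqw e) iv tv.
  by move=> s _; case: eqP.
rewrite exchange_big /= -sum1_card; apply: eq_bigr => v vg.
have vF : vt v \in F by apply/FP; exists v.
rewrite (eq_bigr (fun x => if vt v == x then 1 else 0)%N); last first.
  by move=> x _; case: eqP.
rewrite -big_mkcond sum1_count -(eq_count (a1 := pred1 (vt v))); last first.
  by move=> x /=; rewrite eq_sym.
by rewrite count_uniq_mem ?fset_uniq // vF.
Qed.

Lemma typed_words_cons (t : vertex_type) n (v : n.-tuple V600) (u : V600) :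
  (cons_words u v \in typed_words t n.+1)
  = [&& asc v && inside v, u \notin D v, star v u &
      type_of t #|u |: D v :&: [set x | adj u x]| #|sg v :\ u|].
Proof.
rewrite inE [tval _]/= [asc (u :: v)]/=.
case: (boolP (asc v)) => av; last by rewrite andbF.
rewrite andbT; case: (boolP (u \in D v)) => uD; first by rewrite andbF.
have auv : asc (u :: v) by rewrite /= uD.
case: (boolP (inside (u :: v))) => [iuv|niuv] /=.
  have iv := inside_pred auv iuv; have sv := inside_star iv iuv.
  by rewrite iv sv sg_cons.
case: (boolP (inside v)) => //= iv; case: (boolP (star v u)) => //= sv.
by rewrite (star_step iv sv).1 in niuv.
Qed.

Lemma typed_words_succ (t : vertex_type) n : (0 < n)%N ->
  #|typed_words t n.+1| = (\sum_(c <- predecessors t) c.1 * #|typed_words c.2 n|)%N.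
Proof.
move=> n0; pose f (p : n.-tuple V600 * V600) := cons_words p.2 p.1.
have f_bij : bijective f.
  exists (fun w : n.+1.-tuple V600 => ([tuple of behead w], thead w)).
    by move=> [v u]; congr (_, _); apply: val_inj.
  by move=> w; rewrite /f /= [RHS]tuple_eta; apply: val_inj.
rewrite -sum1_card (reindex f) /=; last exact: onW_bij.
rewrite -(pair_big_dep xpredT (fun (v : n.-tuple V600) u => cons_words u v \in typed_words t n.+1)
  (fun _ _ => 1%N)) /=.
rewrite (eq_bigr (fun v : n.-tuple V600 =>
    \sum_(c <- predecessors t) c.1 * (v \in typed_words c.2 n))%N).
  rewrite exchange_big /=; apply: eq_bigr => c _; rewrite -big_distrr /=; congr (_ * _)%N.
  by rewrite -sum1_card [RHS]big_mkcond; apply: eq_bigr => v _; case: ifP.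
move=> v _; rewrite (eq_bigl _ _ (typed_words_cons t v)).
case: (boolP (asc v && inside v)) => [/andP[av iv]|/negbTE nv] /=; last first.
  by rewrite big_pred0_eq big1 // => c _; rewrite inE andbA nv muln0.
have d1 : (0 < #|D v|)%N.
  have := size_tuple v; case: (tval v) => [|u w] e; first by rewrite -e in n0.
  by apply/card_gt0P; exists u; rewrite /= setU11.
rewrite sum1_card (@succ_count_sets t (D v) (sg v)) //.
- by apply: eq_bigr => c _; rewrite inE av iv.
- have DS a b : a \in D v -> b \in sg v -> adj b a.
    by move=> aD bS; apply: (sg_descent av).
  apply/cliqP => a b; rewrite !in_setU.
  move=> /orP[aD|aS] /orP[bD|bS].
  + exact: (cliq_adj (descent_cliq v)).
  + by move=> _; rewrite adjC; apply: DS.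
  + by move=> _; apply: DS.
  + exact: (cliq_adj (sg_cliq v)).
- apply/pred0P => a /=; apply/negbTE/negP => /andP[aD aS].
  by have := sg_descent av aS aD; rewrite adjxx.
Qed.

Lemma typed_words_1 (t : vertex_type) : #|typed_words t 1| = (if t is T1 then 4 else 0)%N.
Proof.
have f_bij : bijective (fun u => cons_words u [tuple]).
  exists (fun w : 1.-tuple V600 => thead w) => // w.
  by case/tupleP: w => u s; rewrite theadE (tuple0 s); apply: val_inj.
have /andP[ct /eqP t4] := tau_tetra.
have starE u : star [::] u = (u \in tau).
  apply/idP/idP => [/forall_inP|] su; last by apply: star_cliq ct _ su; rewrite sg_nil.
  apply: contraT => ut; exfalso; apply: (cliq_max ct t4 (u := u)) => x xt.
  have := su x; rewrite sg_nil => /(_ xt)/orP[/eqP ux|//].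
  by rewrite ux xt in ut.
rewrite -sum1_card (reindex _ (onW_bij _ f_bij)) /=.
(* At V0 the star is [tau] itself; each of its four letters gives one descent and leaves three
   boundary directions. *)
rewrite (eq_bigl (fun u => (u \in tau) && type_of t 1 3)) => [|u]; last first.
  rewrite typed_words_cons /= inside_nil inE /= starE; case: (boolP (u \in tau)) => //= ut.
  rewrite sg_nil set0I setU0 cards1; congr (type_of t _ _).
  by have := cardsD1 u tau; rewrite ut t4 add1n => -[].
case: t => /=; try by rewrite big_pred0 // => u; rewrite andbF.
by rewrite (eq_bigl (mem tau)) ?sum1_card // => u; rewrite andbT.
Qed.

End Simplex.

Theorem theorem3 (R : realType) (V0 C0 : 'rV[R]_5)
    (hV0 : incident 0 4 V0 C0) :
  let a := value_sum V0 C0 TA in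
  let b := value_sum V0 C0 TB in
  let c := value_sum V0 C0 TC in
  let d := value_sum V0 C0 TD in
  let e := value_sum V0 C0 TE in
  let f := value_sum V0 C0 TF in
  let g := value_sum V0 C0 TG in
  let h := value_sum V0 C0 TH in
  let k := value_sum V0 C0 TK in
  let v := value_sum V0 C0 T1 in
  (forall n : nat, 1 <= n ->
    a n.+1 = 2 * a n + 2 * b n + 3 * v n /\
    b n.+1 = a n + 2 * b n /\
    c n.+1 = 2 * a n + 3 * c n + 2 * d n /\
    d n.+1 = 2 * b n + 3 * c n + 4 * d n + 5 * e n /\
    e n.+1 = 3 * c n + 4 * d n + 6 * e n /\
    f n.+1 = c n + 4 * f n + 2 * g n /\
    g n.+1 = d n + 6 * f n + 6 * g n + 5 * h n /\
    h n.+1 = e n + 12 * f n + 12 * g n + 12 * h n + 12 * k n /\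
    k n.+1 = 94 * f n + 97 * g n + 101 * h n + 107 * k n /\
    v n.+1 = v n)%N /\
  (v 1 = 4 /\ a 1 = 0 /\ b 1 = 0 /\ c 1 = 0 /\ d 1 = 0 /\ e 1 = 0 /\
   f 1 = 0 /\ g 1 = 0 /\ h 1 = 0 /\ k 1 = 0)%N.
Proof.
have [z [A [B [[_ cB /cards0_eq-> B4] [-> ->]]]]] :=
  (incidentP V0 C0 (isT : (0 <= 4 <= 4)%N)).1 hV0.
have tB : tetra B by rewrite /tetra cB B4.
have vs := @value_sum_words R z B tB.
(* With z as [z0] and B as [tau], V0 is the vertex of the empty word. *)
rewrite -[centre R z set0]/(vt R z [::]) -[centre R z B]/(ctr R z [::] B).
split; last by rewrite !vs !typed_words_1.
move=> n n0; rewrite !vs !typed_words_succ // !big_cons !big_nil /=.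
move: #|typed_words R B T1 n| #|typed_words R B TA n| #|typed_words R B TB n| #|typed_words R B TC n|.
move: #|typed_words R B TD n| #|typed_words R B TE n| #|typed_words R B TF n| #|typed_words R B TG n|.
by move: #|typed_words R B TH n| #|typed_words R B TK n|; lia.
Qed.
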